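(* Let $V$ be a $\frac{\mathbb Z}{2}$-graded meromorphic open-string vertex algebra, $\theta$ an involution of $V$, and $(W,Y_W^\theta,\mathbf d_W,D_W)$ a $\theta$-twisted $V$-module. Then for every $n\ge 1$, all homogeneous $v_1,\dots,v_n\in V$ of parities $|v_1|,\dots,|v_n|\in\{0,1\}$, every $w\in W$ and $w'\in W'$, there exists an algebraic function $$f(z_1,\dots,z_n)=\prod_{i=1}^nz_i^{|v_i|/2}\,\frac{g(z_1,\dots,z_n)}{\prod_{i=1}^nz_i^{q_i}\prod_{1\le i<j\le n}(z_i-z_j)^{q_{ij}}},$$ with $g$ a polynomial and $q_i,q_{ij}\in\mathbb N$, such that for every $p\in\mathbb Z$ the series $$\langle w',(Y_W^\theta)^p(v_1,z_1)\cdots(Y_W^\theta)^p(v_n,z_n)w\rangle$$ converges absolutely in the region $|z_1|>\cdots>|z_n|>0$ to the $p$-th branch $$f_{p,\dots,p}(z_1,\dots,z_n)=\prod_{i=1}^ne^{\frac{|v_i|}2l_p(z_i)}\,\frac{g(z_1,\dots,z_n)}{\prod_{i=1}^nz_i^{q_i}\prod_{1\le i<j\le n}(z_i-z_j)^{q_{ij}}}$$ of $f$.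
   Context: $\mathbb N=\{0,1,2,\dots\}$. **$\frac{\mathbb Z}{2}$-graded MOSVA.** A $\frac{\mathbb Z}{2}$-graded meromorphic open-string vertex algebra is a graded space $V=\coprod_{n\in\frac12\mathbb Z}V_{(n)}$ with a linear map $Y_V:V\otimes V\to V[[x,x^{-1}]]$ and a vacuum $\mathbf 1\in V$ such that: $V_{(n)}=0$ for $n$ sufficiently negative; with $\mathbf d_Vv=nv$ for $v\in V_{(n)}$, $[\mathbf d_V,Y_V(u,x)]=Y_V(\mathbf d_Vu,x)+x\frac{d}{dx}Y_V(u,x)$; $Y_V(\mathbf 1,x)=1_V$; $Y_V(u,x)\mathbf 1\in V[[x]]$ with constant term $u$; with $D_Vu=\lim_{x\to0}\frac{d}{dx}Y_V(u,x)\mathbf 1$, $\frac{d}{dx}Y_V(u,x)=Y_V(D_Vu,x)=[D_V,Y_V(u,x)]$; and for all $u_1,v\in V$ there is $P\in\mathbb N$ such that for all $u_2\in V$, $(x_0+x_2)^PY_V(u_1,x_0+x_2)Y_V(u_2,x_2)v=(x_0+x_2)^PY_V(Y_V(u_1,x_0)u_2,x_2)v$. For homogeneous $v$, the parity $|v|$ is $1$ if $v\in\coprod_{n\in\mathbb Z+1/2}V_{(n)}$ and $0$ if $v\in\coprod_{n\in\mathbb Z}V_{(n)}$. **Twisted modules.** An involution $\theta$ of $V$ is a grading-preserving linear isomorphism with $\theta^2=1_V$ and $\theta(Y_V(u,x)v)=Y_V(\theta u,x)\theta v$. A $\theta$-twisted $V$-module is a $\mathbb C$-graded space $W=\coprod_{n\in\mathbb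 C}W_{(n)}$ with a linear map $Y_W^\theta:V\otimes W\to W[[x^{1/2},x^{-1/2}]]$, $v\otimes w\mapsto Y_W^\theta(v,x)w=\sum_{n\in\frac12\mathbb Z}v_nw\,x^{-n-1}$, an operator $\mathbf d_W$ of weight $0$ and an operator $D_W$ of weight $1$ (no axiom is imposed on $D_W$), such that: (1) $W_{(m)}=0$ when $\mathrm{Re}(m)$ is sufficiently negative; $\mathbf d_Ww=mw$ for $w\in W_{(m)}$; $[\mathbf d_W,Y_W^\theta(u,x)]=Y_W^\theta(\mathbf d_Vu,x)+x\frac{d}{dx}Y_W^\theta(u,x)$; (2) $Y_W^\theta(\mathbf 1,x)=1_W$; (3) $\frac{d}{dx}Y_W^\theta(u,x)=Y_W^\theta(D_Vu,x)$; (4) for every homogeneous $v_1\in V$ and $w\in W$ there is $P\in\mathbb N$ such that for every homogeneous $v_2\in V$, $$(x_0+x_2)^{P+|v_1|/2}x_2^{|v_2|/2}Y_W^\theta(v_1,x_0+x_2)Y_W^\theta(v_2,x_2)w=(x_0+x_2)^{P+|v_1|/2}x_2^{|v_2|/2}Y_W^\theta(Y_V(v_1,x_0)v_2,x_2)w$$ as series in $W((x_0,x_2))$ (on the left, powers of $x_0+x_2$ are expanded in nonnegative powers of $x_2$; on the right, in nonnegative powers of $x_0$). **Branches.** For $z\in\mathbb C^\times$ and $p\in\mathbb Z$, $l_p(z)=\log|z|+i(\arg z+2\pi p)$ with $\arg z\in[0,2\pi)$. $W'=\coprod_{n\in\mathbb C}W_{(n)}^*$ is the restricted dual and $\overline W=\prod_nW_{(n)}$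 the algebraic completion. The $p$-th branch of $Y_W^\theta$ is $(Y_W^\theta)^p(v,z)=\sum_{n\in\frac12\mathbb Z}v_n\,e^{(-n-1)l_p(z)}$. The product is understood as the multiple series obtained by expanding each vertex operator into its components. *)

(* Defs.v *)
From HB Require Import structures.
From mathcomp Require Import all_boot all_order all_algebra.
From mathcomp Require Import finmap.
From mathcomp Require Import all_classical all_reals all_analysis.
From mathcomp Require Import complex ring lra.
(* The notations of mpoly.v clash with those of MathComp-Analysis. *)
From mathcomp Require Export -(notations) mpoly.

Set Implicit Arguments.
Unset Strict Implicit.
Unset Printing Implicit Defensive.

Import Order.TTheory GRing.Theory Num.Theory.
Import ComplexField.

Local Open Scope classical_set_scope.
Local Open Scope ring_scope.

(* Half-integers are encoded by their doubles: [k : int] stands for [k / 2].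
   This applies to the weights of V, to the exponents of formal series and to
   the indices of modes. *)

Definition oddz (k : int) : bool := odd `|k|%N.

Definition half {K : fieldType} (k : int) : K := k%:~R / 2.

(* c (c - 1) ... (c - j + 1) / j! *)
Definition gbinom {K : fieldType} (c : K) (j : nat) : K :=
  (\prod_(i < j) (c - i%:R)) / (j`!)%:R.

Section GradedSpaces.
Context {K : fieldType}.

Definition is_subspace (V : lmodType K) (S : set V) : Prop :=
  S 0 /\ forall (a : K) (u v : V), S u -> S v -> S (a *: u + v).

(* V is the internal direct sum of the subspaces S i. *)
Definition is_coproduct (I : choiceType) (V : lmodType K) (S : I -> set V) :=
  (forall i, is_subspace (S i)) /\
  forall v : V, exists! c : I -> V,
    [/\ forall i, S i (c i), finite_set [set i | c i != 0]
      & v = \sum_(i \in [set: I]) c i].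

End GradedSpaces.

Section FormalSeries.
Context {K : fieldType}.

(* f k is the coefficient of x^(k/2) in f. *)
Definition hseries (U : Type) := int -> U.

(* T a b is the coefficient of x0^(a/2) x2^(b/2) in T. *)
Definition hseries2 (U : Type) := int -> int -> U.

(* d/dx; note that (d/dx x^((k+2)/2)) = (k+2)/2 x^(k/2). *)
Definition fderiv (U : lmodType K) (f : hseries U) : hseries U :=
  fun k => half (k + 2) *: f (k + 2).

Definition fmulx (U : Type) (f : hseries U) : hseries U := fun k => f (k - 2).

(* Membership in U((x0, x2)). *)
Definition in_laurent2 (U : lmodType K) (T : hseries2 U) : Prop :=
  exists N : int, forall a b : int, T a b != 0 ->
    [/\ ~~ oddz a, ~~ oddz b, N <= a & N <= b].

(* The series
     (x0 + x2)^(r/2) x2^(s/2) Y(u1, x0 + x2) Y(u2, x2) w,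
   powers of x0 + x2 being expanded in nonnegative powers of x2: it is
     \sum_(m, n) Y_m(u1) Y_n(u2) w (x0 + x2)^((m+r)/2) x2^((n+s)/2)
   where (x0 + x2)^((m+r)/2) contributes
     \sum_j gbinom ((m+r)/2) j x0^((m+r)/2 - j) x2^j.
   The finitely supported sum \sum_(j \in _) is legitimate when Y(u2, x) w is
   lower truncated; under the axioms below it always is. *)
Definition product_series (V W : lmodType K)
    (Y : int -> {bilinear V -> W -> W}) (r s : int) (u1 u2 : V) (w : W) :
    hseries2 W :=
  fun a b => \sum_(j \in [set: nat])
    gbinom (half (a + 2 * j%:Z)) j *:
      Y (a + 2 * j%:Z - r) u1 (Y (b - 2 * j%:Z - s) u2 w).

(* The series
     (x0 + x2)^(r/2) x2^(s/2) Y(Y'(u1, x0) u2, x2) w,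
   powers of x0 + x2 being expanded in nonnegative powers of x0.  The sum is
   finite as soon as Y'(u1, x) u2 is lower truncated. *)
Definition iterate_series (V W : lmodType K)
    (Y' : int -> {bilinear V -> V -> V}) (Y : int -> {bilinear V -> W -> W})
    (r s : int) (u1 u2 : V) (w : W) : hseries2 W :=
  fun a b => \sum_(j \in [set: nat])
    gbinom (half r) j *:
      Y (b - s - (r - 2 * j%:Z)) (Y' (a - 2 * j%:Z) u1 u2) w.

End FormalSeries.

Section MOSVA.
Context {R : realType}.
Local Notation C := R[i].

(* D_V u is the constant term of (d/dx) Y_V(u, x) 1. *)
Definition D_of (V : lmodType C) (Y : int -> {bilinear V -> V -> V}) (vac : V)
    (u : V) : V :=
  fderiv (fun k => Y k u vac) 0.

(* Z/2-graded meromorphic open-string vertex algebras; Y_V k u v is the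
   coefficient of x^(k/2) in Y_V(u, x) v, so that it vanishes for odd k. *)
Record mosva (V : lmodType C) := Mosva {
  wt_V : int -> set V;
  Y_V : int -> {bilinear V -> V -> V};
  vacuum : V;
  d_V : {linear V -> V};
  D_V := D_of Y_V vacuum;
  wt_V_coproduct : is_coproduct wt_V;
  Y_V_integral : forall k u v, oddz k -> Y_V k u v = 0;
  wt_V_bounded : exists N : int, forall k, k < N -> wt_V k `<=` [set 0];
  d_V_wt : forall k v, wt_V k v -> d_V v = half k *: v;
  d_V_bracket : forall k u v,
    d_V (Y_V k u v) - Y_V k u (d_V v)
      = Y_V k (d_V u) v + fmulx (fderiv (fun l => Y_V l u v)) k;
  Y_V_vacuum : forall k v, Y_V k vacuum v = if k == 0 then v else 0;
  Y_V_creation : forall u,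
    (forall k, k < 0 -> Y_V k u vacuum = 0) /\ Y_V 0 u vacuum = u;
  Y_V_derivative : forall k u v,
    fderiv (fun l => Y_V l u v) k = Y_V k (D_V u) v;
  Y_V_D_bracket : forall k u v,
    fderiv (fun l => Y_V l u v) k = D_V (Y_V k u v) - Y_V k u (D_V v);
  Y_V_assoc : forall u1 v, exists P : nat, forall u2,
    product_series Y_V (2 * P%:Z) 0 u1 u2 v
      = iterate_series Y_V Y_V (2 * P%:Z) 0 u1 u2 v
}.

(* The parity of v is e; the zero vector is homogeneous of both parities. *)
Definition homogeneous (V : lmodType C) (A : mosva V) (v : V) (e : bool) :=
  exists2 k : int, wt_V A k v & oddz k = e.

(* Bijectivity is a consequence of involutivity. *)
Record involution (V : lmodType C) (A : mosva V) := Involution {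
  inv_map :> {linear V -> V};
  inv_wt : forall k v, wt_V A k v -> wt_V A k (inv_map v);
  inv_invol : forall v, inv_map (inv_map v) = v;
  inv_Y : forall k u v,
    inv_map (Y_V A k u v) = Y_V A k (inv_map u) (inv_map v)
}.

(* Y_W k v w is the coefficient of x^(k/2) in Y_W(v, x) w.  The involution
   theta is part of the type but none of the axioms involves it. *)
Record twisted_module (V : lmodType C) (A : mosva V) (theta : involution A)
    (W : lmodType C) := TwistedModule {
  wt_W : C -> set W;
  Y_W : int -> {bilinear V -> W -> W};
  d_W : {linear W -> W};
  D_W : {linear W -> W};
  wt_W_coproduct : is_coproduct wt_W;
  d_W_weight0 : forall m w, wt_W m w -> wt_W m (d_W w);
  D_W_weight1 : forall m w, wt_W m w -> wt_W (m + 1) (D_W w);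
  wt_W_bounded : exists N : R, forall m : C, complex.Re m < N ->
    wt_W m `<=` [set 0];
  d_W_wt : forall m w, wt_W m w -> d_W w = m *: w;
  d_W_bracket : forall k u w,
    d_W (Y_W k u w) - Y_W k u (d_W w)
      = Y_W k (d_V A u) w + fmulx (fderiv (fun l => Y_W l u w)) k;
  Y_W_vacuum : forall k w, Y_W k (vacuum A) w = if k == 0 then w else 0;
  Y_W_derivative : forall k u w,
    fderiv (fun l => Y_W l u w) k = Y_W k (D_V A u) w;
  Y_W_assoc : forall v1 e1 w, homogeneous A v1 e1 ->
    exists P : nat, forall v2 e2, homogeneous A v2 e2 ->
      let r := 2 * P%:Z + e1%:Z in
      let s := e2%:Z in
      [/\ in_laurent2 (product_series Y_W r s v1 v2 w),
          in_laurent2 (iterate_series (Y_V A) Y_W r s v1 v2 w)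
        & product_series Y_W r s v1 v2 w
            = iterate_series (Y_V A) Y_W r s v1 v2 w]
}.

Section Correlators.
Context {V : lmodType C} {A : mosva V} {theta : involution A} {W : lmodType C}.
Variable M : twisted_module theta W.

(* The mode v_(m/2), that is, the coefficient of x^(-m/2-1) in Y_W(v, x). *)
Definition mode (v : V) (m : int) (w : W) : W := Y_W M (- m - 2) v w.

(* W' = \coprod_m W_(m)^* is identified with the space of linear forms on W
   that vanish on all but finitely many of the W_(m). *)
Definition restricted_dual (w' : {scalar W}) : Prop :=
  finite_set [set m : C | exists2 w, wt_W M m w & w' w != 0].

End Correlators.

End MOSVA.

Section Branches.
Context {R : realType}.
Local Notation C := R[i].
Local Notation normc := Normc.normc.

Definition cexp (z : C) : C :=
  Complex (expR (complex.Re z) * cos (complex.Im z))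
          (expR (complex.Re z) * sin (complex.Im z)).

Definition is_arg (z : C) (t : R) : Prop :=
  (0 <= t < 2 * pi) /\ z = Complex (normc z * cos t) (normc z * sin t).

Definition arg (z : C) : R := xget 0 [set t | is_arg z t].

Definition logp (p : int) (z : C) : C :=
  Complex (ln (normc z)) (arg z + 2 * pi * p%:~R).

(* Absolute convergence of a multiple series, together with its sum, taken
   along the finite sets of indices ordered by inclusion. *)
Definition converges_absolutely_to (I : choiceType) (t : I -> C) (l : C) :=
  summable [set: I] (fun i => (normc (t i))%:E) /\
  forall eps : R, 0 < eps -> exists F0 : {fset I}, forall F : {fset I},
    (F0 `<=` F)%fset -> normc (\sum_(i <- F) t i - l) < eps.

Context {V : lmodType C} {A : mosva V} {theta : involution A} {W : lmodType C}.

(* The terms of the multiple series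
     < w', Y^p(v_1, z_1) ... Y^p(v_n, z_n) w >,
   indexed by the (doubled) indices m_1, ..., m_n of the modes. *)
Definition correlator_term (M : twisted_module theta W) (p : int) (n : nat)
    (v : 'I_n -> V) (z : 'I_n -> C) (w : W) (w' : {scalar W})
    (m : {ffun 'I_n -> int}) : C :=
  w' (foldr (fun i x => mode M (v i) (m i) x) w (enum 'I_n))
    * \prod_(i < n) cexp ((- half (m i) - 1) * logp p (z i)).

(* The branch f_(p, ..., p) of the algebraic function
     f = \prod_i z_i^(e_i/2)
         g(z) / (\prod_i z_i^(q_i) \prod_(i < j) (z_i - z_j)^(qq_ij)). *)
Definition algebraic_branch (p : int) (n : nat) (e : 'I_n -> bool)
    (g : mpoly n C) (q : 'I_n -> nat) (qq : 'I_n -> 'I_n -> nat)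
    (z : 'I_n -> C) : C :=
  (\prod_(i < n) cexp ((e i)%:R / 2 * logp p (z i)))
    * (meval z g /
         ((\prod_(i < n) z i ^+ q i)
          * \prod_(i < n) \prod_(j < n | (i < j)%N) (z i - z j) ^+ qq i j)).

Definition radially_ordered (n : nat) (z : 'I_n -> C) : Prop :=
  (forall i j : 'I_n, (i < j)%N -> normc (z j) < normc (z i)) /\
  (forall i : 'I_n, 0 < normc (z i)).

End Branches.

Section ArgTheory.
Context {R : realType}.
Local Notation normc := Normc.normc.

Lemma argP (z : R[i]) : z != 0 -> is_arg z (arg z).
Proof.
case: z => a b z0; set z := Complex a b; set r := normc z.
have r2 : r ^+ 2 = a ^+ 2 + b ^+ 2.
  by rewrite /r /z /= sqr_sqrtr // addr_ge0 ?sqr_ge0.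
have r_gt0 : 0 < r.
  rewrite lt0r sqrtr_ge0 andbT; apply/eqP => /Normc.eq0_normc z00.
  by move: z0; rewrite -/z z00 eqxx.
have rn0 : r != 0 by rewrite gt_eqF.
have ar : a = r * (a / r) by field.
have h2 : (a / r) ^+ 2 = 1 - b ^+ 2 / r ^+ 2.
  by have -> : b ^+ 2 = r ^+ 2 - a ^+ 2 by [rewrite r2; ring]; field.
have b2 : 0 <= b ^+ 2 / r ^+ 2 by rewrite divr_ge0 ?sqr_ge0.
have abs_ar : `|a / r| <= 1.
  by rewrite -(@expr_le1 _ 2) // real_normK ?num_real // h2; lra.
have ar1 : -1 <= a / r <= 1 by rewrite -ler_norml.
have sacos : r * sin (acos (a / r)) = `|b|.
  rewrite sin_acos // h2 opprB addrC subrK -expr_div_n sqrtr_sqr normrM.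
  by rewrite normfV (gtr0_norm r_gt0) mulrC divfK.
have pi0 := pi_gt0 R.
suff [t ht] : exists t, is_arg z t by apply: (@xgetPex _ 0 [set t | is_arg z t]%classic); exists t.
have [b0|b0] := leP 0 b.
  exists (acos (a / r)); split.
    have := acos_ge0 ar1; have := acos_lepi ar1; lra.
  by rewrite -/r sacos (ger0_norm b0) acosK ?in_itv //= -ar.
exists (2 * pi - acos (a / r)); split.
  have /acos_gt0 : -1 <= a / r < 1.
    rewrite (andP ar1).1 lt_neqAle (andP ar1).2 andbT; apply/eqP => e1.
    have : b ^+ 2 / r ^+ 2 = 0 by move: h2; rewrite e1 expr1n; lra.
    move/eqP; rewrite mulf_eq0 invr_eq0 !expf_eq0 /= (negbTE rn0) orbF.
    by rewrite lt_eqF.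
  have := acos_lepi ar1; lra.
have -> : 2 * pi - acos (a / r) = - acos (a / r) + pi *+ 2 by rewrite mulr2n; ring.
rewrite -/r cosD (sinD (- _)) cosN sinN sin2pi cos2pi.
rewrite !mulr1 !mulr0 subr0 addr0 mulrN sacos ltr0_norm // opprK.
by rewrite acosK ?in_itv //= -ar.
Qed.

Lemma cexp_logp (p : int) (z : R[i]) : z != 0 -> cexp (logp p z) = z.
Proof.
move=> z0; have [_ ez] := argP z0.
have n0 : 0 < normc z.
  rewrite lt0r; case: (z) z0 => a b z0; rewrite sqrtr_ge0 andbT.
  by apply/eqP => /Normc.eq0_normc z00; rewrite z00 eqxx in z0.
have per (m : int) (t : R) : cos (t + 2 * pi * m%:~R) = cos t /\ sin (t + 2 * pi * m%:~R) = sin t.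
  have pn (k : nat) (u : R) : cos (u + 2 * pi * k%:R) = cos u /\ sin (u + 2 * pi * k%:R) = sin u.
    elim: k u => [|k IH] u; first by rewrite mulr0 addr0.
    have -> : u + 2 * pi * k.+1%:R = (u + 2 * pi * k%:R) + pi *+ 2 by rewrite -natr1 mulr2n; ring.
    by rewrite cosD (sinD (u + _)) cos2pi sin2pi !mulr1 !mulr0 subr0 addr0.
  case: m => k; first exact: pn.
  have [<- <-] := pn k.+1 (t + 2 * pi * (Negz k)%:~R).
  by rewrite NegzE rmorphN /= mulrN subrK.
have [hc hs] := per p (arg z).
by rewrite /cexp /logp /= lnK ?posrE // hc hs -ez.
Qed.

End ArgTheory.

(* Main.v *)
(* Write x_l = z_l - z_n.  The order P in weak associativity does not depend on
   the second vector, so associativity can be iterated: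
     \prod_(l < n) (x_l + z_n)^(r_l/2) Y(v_1, x_1 + z_n) ... Y(v_n, z_n) w
       = \prod_(l < n) (x_l + z_n)^(r_l/2) Y(Y_V(v_1, x_1) ... v_n, z_n) w,
   where x_l + z_n is expanded in powers of z_n on the left, of x_l on the right.
   By induction on n, applied to V as a module over itself, the poles of the
   inner product in x_1 are cleared by a power of x_1 and of the x_1 - x_l.
   Undoing the substitution, the poles of Y(v_1, z_1) ... Y(v_n, z_n) w in z_1 are
   cleared by powers of z_1 and of the z_1 - z_l, whatever the other exponents.
   Doing so for every variable and bounding the total degree by the weights
   leaves a polynomial; dividing back by z_i - z_j is a geometric series, which
   converges absolutely for |z_i| > |z_j|.

   As in the definitions, exponents of formal series are doubled; a series in
   variables indexed by I is a function on {ffun I -> int}. *)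

Require Import Defs.
From HB Require Import structures.
From mathcomp Require Import all_boot all_order all_algebra.
From mathcomp Require Import finmap.
From mathcomp Require Import all_classical all_reals all_analysis.
From mathcomp Require Import complex zify ring lra.
From mathcomp Require Import -(notations) mpoly.

Set Implicit Arguments.
Unset Strict Implicit.
Unset Printing Implicit Defensive.

Import Order.TTheory GRing.Theory Num.Theory.
Local Open Scope ring_scope.

Local Notation half := Defs.half.

(** * Finite sums and generalized binomial coefficients *)

Lemma sum_ord_widen (U : nmodType) (F : nat -> U) (m n : nat) :
  (m <= n)%N -> (forall j, (m <= j)%N -> F j = 0) ->
  \sum_(j < n) F j = \sum_(j < m) F j.
Proof.
move=> mn F0; rewrite -!(big_mkord predT) (big_cat_nat _ mn) //=.
rewrite [X in _ + X]big1_seq ?addr0 // => j.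
by rewrite mem_index_iota => /andP[_ /andP[/F0]].
Qed.

Lemma fsum_nat (U : nmodType) (F : nat -> U) (m : nat) :
  (forall j, (m <= j)%N -> F j = 0) ->
  \sum_(j \in [set: nat]%classic) F j = \sum_(j < m) F j.
Proof.
move=> F0; rewrite (fsbig_ord _ _ F); apply/esym/fsbig_widen => //= j [_ /= jm].
by apply: F0; rewrite leqNgt; apply/negP.
Qed.

Lemma halfz_even {K : numFieldType} (m : int) : half (2 * m) = m%:~R :> K.
Proof. by rewrite /half intrM mulrC mulKf. Qed.

Lemma halfz_D {K : numFieldType} (a b : int) : half (a + b) = half a + half b :> K.
Proof. by rewrite /half intrD mulrDl. Qed.

Lemma gbinom0 {K : numFieldType} (c : K) : gbinom c 0 = 1.
Proof. by rewrite /gbinom big_ord0 fact0 divr1. Qed.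

Lemma gbinom_pascal {K : numFieldType} (c : K) (j : nat) :
  gbinom c j.+1 = gbinom (c - 1) j.+1 + gbinom (c - 1) j.
Proof.
have fact_neq0 m : (m`!)%:R != 0 :> K by rewrite pnatr_eq0 -lt0n fact_gt0.
rewrite /gbinom big_ord_recl big_ord_recr /=.
under eq_bigr => i _.
  rewrite (_ : c - _ = c - 1 - i%:R); last by rewrite -[bump _ _]/i.+1 -natr1; ring.
  over.
set p := \prod_(i < j) _; rewrite factS natrM.
have s0 : j.+1%:R != 0 :> K by rewrite pnatr_eq0.
field; exact/andP.
Qed.

Lemma gbinom_small {K : numFieldType} (m j : nat) :
  (m < j)%N -> gbinom (m%:R : K) j = 0.
Proof.
move=> mj; rewrite /gbinom (bigD1 (Ordinal mj)) //= subrr !mul0r //.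
Qed.

(** * Formal series and the substitution x_l := x_l + x_h *)

Section Formal.
Variables (K : numFieldType) (I : finType).
Local Notation idx := {ffun I -> int}.

(* The exponent of x_i itself, exponents being doubled. *)
Definition dbl (i : I) : idx := [ffun j => if j == i then 2 else 0].

Lemma idxB (k l : idx) i : (k - l) i = k i - l i.
Proof. by rewrite !ffunE. Qed.

Lemma idxD (k l : idx) i : (k + l) i = k i + l i.
Proof. by rewrite !ffunE. Qed.

Lemma idxMn (k : idx) i n : (k *+ n) i = k i * n%:Z.
Proof. by rewrite ffunMnE -mulr_natr natz. Qed.

Lemma dblE i j : dbl i j = if j == i then 2 else 0.
Proof. by rewrite ffunE. Qed.

Definition idxE := (idxB, idxD, idxMn, dblE).

Lemma oddz_dbl (k : idx) i j : oddz ((k - dbl j) i) = oddz (k i).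
Proof. by rewrite !idxE /oddz; case: eqP; lia. Qed.

(** As [f k] is the coefficient with doubled exponents [k], this is multiplication by x_i.
    Accordingly [mulD i j] is multiplication by x_i - x_j, and [mulDs i Q s] by the product over j
    in s of the (x_i - x_j)^(Q j). *)
Definition mulX (U : zmodType) (i : I) (f : idx -> U) : idx -> U :=
  fun k => f (k - dbl i).

Definition mulD (U : zmodType) (i j : I) (f : idx -> U) : idx -> U :=
  fun k => mulX i f k - mulX j f k.

Definition mulDs (U : zmodType) (i : I) (Q : I -> nat) (s : seq I)
    (f : idx -> U) : idx -> U :=
  foldr (fun j g => iter (Q j) (mulD i j) g) f s.

(** The tool for moving [mulDs] through other operators: with the graph of an operator as [P], only
    a single factor x_i - x_j has to be treated. *)
Lemma mulDs_rel (U U' : zmodType) (P : (idx -> U) -> (idx -> U') -> Prop)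
    i Q (s : seq I) f f' :
  (forall j g g', j \in s -> P g g' -> P (mulD i j g) (mulD i j g')) ->
  P f f' -> P (mulDs i Q s f) (mulDs i Q s f').
Proof.
elim: s => //= j s IH Pm Pf.
elim: (Q j) => /= [|n IHn]; first by apply: IH => // l g g' ls; apply: Pm; rewrite inE ls orbT.
by apply: Pm => //; rewrite mem_head.
Qed.

Lemma mulDs_ind (U : zmodType) (P : (idx -> U) -> Prop) i Q (s : seq I) f :
  (forall j g, j \in s -> P g -> P (mulD i j g)) -> P f -> P (mulDs i Q s f).
Proof. move=> Pm Pf.
by apply: (@mulDs_rel U U (fun g _ => P g) i Q s f f) => // j g _; exact: Pm. Qed.

Lemma eq_mulDs (U : zmodType) i Q Q' (s : seq I) (f : idx -> U) :
  {in s, Q =1 Q'} -> mulDs i Q s f = mulDs i Q' s f.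
Proof.
elim: s => //= j s IH QQ; rewrite QQ ?mem_head // IH // => l ls.
by apply: QQ; rewrite inE ls orbT.
Qed.

Lemma mulDs_rcons (U : zmodType) i Q (s : seq I) h (f : idx -> U) :
  mulDs i Q (rcons s h) f = mulDs i Q s (iter (Q h) (mulD i h) f).
Proof. by rewrite /mulDs foldr_rcons. Qed.

Lemma iter_mulX (U : zmodType) i n (f : idx -> U) k :
  iter n (mulX i) f k = f (k - dbl i *+ n).
Proof.
elim: n k => [|n IH] k /=; first by rewrite mulr0n subr0.
by rewrite /mulX IH mulrS opprD addrA.
Qed.

Definition truncated (U : zmodType) (N : int) (h : I) (f : idx -> U) :=
  forall k : idx, k h < N -> f k = 0.

Lemma truncated_mulX (U : zmodType) N h i (f : idx -> U) :
  truncated N h f -> truncated N h (mulX i f).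
Proof.
move=> fN k kN; apply: fN; rewrite !idxE; case: eqP => _; lia.
Qed.

Lemma truncated_mulD (U : zmodType) N h i j (f : idx -> U) :
  truncated N h f -> truncated N h (mulD i j f).
Proof.
by move=> fN k kN; rewrite /mulD !(truncated_mulX _ fN) ?subrr.
Qed.

Section Shift.
Variables (U : lmodType K) (N : int) (h : I).
Implicit Types f : idx -> U.

(* The substitution x_l := x_l + x_h, expanded in nonnegative powers of x_h;
   the bound on j loses nothing on truncated series. *)
Definition shiftX (l : I) f : idx -> U := fun k =>
  \sum_(j < `|k h - N|.+1)
    gbinom (half (k l + 2 * j%:Z)) j *: f (k + (dbl l - dbl h) *+ j).

Lemma step_idx l (k : idx) j : l != h -> (k + (dbl l - dbl h) *+ j) h = k h - 2 * j%:Z.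
Proof.
move=> lh; rewrite !idxE eqxx [h == l]eq_sym (negbTE lh) /=.
lia.
Qed.

Lemma step_idxl l (k : idx) j : l != h -> (k + (dbl l - dbl h) *+ j) l = k l + 2 * j%:Z.
Proof.
by move=> lh; rewrite !idxE eqxx (negbTE lh) /=; lia.
Qed.

Lemma step_idxm l m (k : idx) j : m != l -> m != h -> (k + (dbl l - dbl h) *+ j) m = k m.
Proof.
by move=> ml mh; rewrite !idxE (negbTE ml) (negbTE mh) /=; lia.
Qed.

(** The length of the sum in [shiftX] depends on [k]; a free length [n] lets sums at different
    exponents be compared term by term. *)
Lemma shiftXE l f (k : idx) (n : nat) : l != h -> truncated N h f ->
  k h - 2 * n%:Z < N ->
  shiftX l f k = \sum_(j < n)
    gbinom (half (k l + 2 * j%:Z)) j *: f (k + (dbl l - dbl h) *+ j).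
Proof.
move=> lh fN kn; set F := fun j : nat => gbinom (half (k l + 2 * j%:Z)) j *: f (k + (dbl l - dbl h) *+ j).
rewrite /shiftX -!/(F _) -(@sum_ord_widen _ F _ (maxn n `|k h - N|.+1)) ?leq_maxr //.
  rewrite (@sum_ord_widen _ F n) ?leq_maxl // => j nj.
  by rewrite /F fN ?scaler0 // step_idx //; lia.
by move=> j nj; rewrite /F fN ?scaler0 // step_idx //; lia.
Qed.

Lemma truncated_shiftX l f : l != h -> truncated N h f -> truncated N h (shiftX l f).
Proof.
move=> lh fN k kN; rewrite /shiftX big1 // => j _; rewrite fN ?scaler0 //.
by rewrite step_idx //; lia.
Qed.

Lemma shiftXB l f g k :
  shiftX l (fun k => f k - g k) k = shiftX l f k - shiftX l g k.
Proof. by rewrite /shiftX -sumrB; apply: eq_bigr => j _; rewrite scalerBr. Qed.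

Lemma shiftX_mulX l m f : l != h -> m != l -> truncated N h f ->
  shiftX l (mulX m f) = mulX m (shiftX l f).
Proof.
move=> lh ml fN; apply/funext => k; pose n := `|k h - N|.+1.
rewrite (@shiftXE _ _ _ n) //; [|exact: truncated_mulX|by rewrite /n; lia].
rewrite [in RHS]/mulX (@shiftXE _ _ _ n) //; last first.
  by rewrite /n !idxE; case: eqP; lia.
apply: eq_bigr => j _; rewrite /mulX addrAC.
by rewrite !idxE eq_sym (negbTE ml) oppr0 addr0.
Qed.

Lemma shiftX_mulXl l f : l != h -> truncated N h f ->
  shiftX l (mulX l f) = fun k => mulX l (shiftX l f) k + mulX h (shiftX l f) k.
Proof.
move=> lh fN; apply/funext => k.
(* The x_h part needs one summand fewer, being read at a lower exponent of x_h. Once j = 0 is peeled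
   off, Pascal's rule combines summand j + 1 of the x_l part with summand j of the x_h part. *)
have [n kn] : exists n : nat, k h - 2 * n.+1%:Z < N by exists `|k h - N|%N; lia.
rewrite (@shiftXE _ _ _ n.+1) //; last exact: truncated_mulX.
rewrite /mulX (@shiftXE _ _ (k - dbl l) n.+1) //; last first.
  by rewrite !idxE eq_sym (negbTE lh) /=; lia.
rewrite (@shiftXE _ _ (k - dbl h) n) //; last first.
  by rewrite !idxE eqxx /=; lia.
rewrite !big_ord_recl !gbinom0 !scale1r !mulr0n !addr0 -addrA; congr (_ + _).
rewrite -big_split /=; apply: eq_bigr => j _.
have ek : k + (dbl l - dbl h) *+ j.+1 - dbl l = k - dbl h + (dbl l - dbl h) *+ j.
  by apply/ffunP => m; rewrite !idxE; case: eqP; case: eqP => _ _ /=; lia.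
rewrite -[bump 0 j]/j.+1 [k - dbl l + _]addrAC ek -scalerDl; congr (_ *: _).
rewrite !idxE eqxx (negbTE lh) subr0 gbinom_pascal.
have <- : half (k l + 2 * j%:Z) = half (k l + 2 * j.+1%:Z) - 1 :> K.
  by rewrite !halfz_D !halfz_even; rewrite -!pmulrn -natr1; ring.
by congr (gbinom (half _) _ + _); lia.
Qed.

(* A triangular system in the exponent of x_h. *)
Lemma shiftX_vanish (P : pred idx) l f : l != h -> truncated N h f ->
  (forall k, P k -> shiftX l f k = 0) ->
  (forall (k : idx) j, P k -> P (k + (dbl l - dbl h) *+ j.+1) \/
     gbinom (half (k l + 2 * j.+1%:Z)) j.+1 *: f (k + (dbl l - dbl h) *+ j.+1) = 0) ->
  forall k, P k -> f k = 0.
Proof.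
move=> lh fN Tf HP k; move: {2}`|k h - N|.+1 (ltnSn `|k h - N|) => n.
elim: n k => [|n IH] k; first by [].
move=> kn Pk; case: (ltP (k h) N) => [/fN //|kN].
have := Tf k Pk; rewrite /shiftX big_ord_recl gbinom0 scale1r mulr0n addr0 big1 ?addr0 //.
move=> j _; rewrite -[nat_of_ord (lift _ _)]/(j.+1).
case: (HP k j Pk) => // Pj.
case: (ltP ((k + (dbl l - dbl h) *+ j.+1) h) N) => [/fN -> |kjN]; first by rewrite scaler0.
rewrite (IH _ _ Pj) ?scaler0 //; move: kjN; rewrite step_idx //; lia.
Qed.

Definition shiftXs (s : seq I) f := foldr shiftX f s.

Lemma truncated_shiftXs s f : h \notin s -> truncated N h f -> truncated N h (shiftXs s f).
Proof.
elim: s => //= l s IH; rewrite inE negb_or eq_sym => /andP[lh hs] fN.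
exact/truncated_shiftX/IH.
Qed.

Lemma shiftXsB s f g : 
  shiftXs s (fun k => f k - g k) = fun k => shiftXs s f k - shiftXs s g k.
Proof.
elim: s => //= l s IH; apply/funext => k; rewrite IH; exact: shiftXB.
Qed.

Lemma shiftXs_mulX m s f : h \notin s -> m \notin s -> truncated N h f ->
  shiftXs s (mulX m f) = mulX m (shiftXs s f).
Proof.
elim: s => //= l s IH; rewrite !inE !negb_or eq_sym => /andP[lh hs] /andP[ml ms] fN.
by rewrite IH // shiftX_mulX //; exact: truncated_shiftXs.
Qed.

Lemma shiftXD l f g k :
  shiftX l (fun k => f k + g k) k = shiftX l f k + shiftX l g k.
Proof. by rewrite /shiftX -big_split; apply: eq_bigr => j _; rewrite scalerDr. Qed.

Lemma shiftXs_mulXl l s f : h \notin s -> uniq s -> l \in s -> truncated N h f ->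
  shiftXs s (mulX l f) = fun k => mulX l (shiftXs s f) k + mulX h (shiftXs s f) k.
Proof.
elim: s => //= i s IH; rewrite !inE !negb_or eq_sym => /andP[ih hs] /andP[iNs us] ls fN.
have gN := truncated_shiftXs hs fN.
have hi : h != i by rewrite eq_sym.
have [li|li] := eqVneq l i.
  rewrite li shiftXs_mulX // shiftX_mulXl //.
rewrite IH //; last by move: ls; rewrite (negbTE li).
by apply/funext => k; rewrite shiftXD !shiftX_mulX.
Qed.

(** Both variables receive the same increment x_h, which cancels in the difference. *)
Lemma shiftXs_mulD l m s f : h \notin s -> uniq s -> l \in s -> m \in s ->
  truncated N h f -> shiftXs s (mulD l m f) = mulD l m (shiftXs s f).
Proof.
move=> hs us ls ms fN; rewrite /mulD shiftXsB !shiftXs_mulXl //.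
by apply/funext => k; rewrite opprD addrACA subrr addr0.
Qed.

(** Since (x_l + x_h) - x_h = x_l, a pole at x_l = 0 after the substitution is cleared by a power of
    x_l - x_h before it. *)
Lemma shiftXs_mulDh l s f : h \notin s -> uniq s -> l \in s ->
  truncated N h f -> shiftXs s (mulD l h f) = mulX l (shiftXs s f).
Proof.
move=> hs us ls fN; rewrite /mulD shiftXsB shiftXs_mulXl // shiftXs_mulX //.
by apply/funext => k; rewrite addrK.
Qed.

(* Binomial coefficients ((a + j) choose j) with a < 0 <= a + j vanish. *)
Lemma shiftXs_reflect i s f : h \notin i :: s -> i \notin s -> truncated N h f ->
  (forall k : idx, oddz (k i) -> f k = 0) ->
  (forall k : idx, k i < 0 -> shiftXs (i :: s) f k = 0) ->
  forall k : idx, k i < 0 -> f k = 0.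
Proof.
rewrite inE negb_or eq_sym => /andP[ih hs] iNs fN fo Tf.
(* The substitutions in [s] leave the exponent of x_i alone, so vanishing under a condition on that
   exponent passes through them in both directions. *)
have slice (P : int -> bool) g : truncated N h g ->
    (forall k : idx, P (k i) -> shiftXs s g k = 0) <-> (forall k : idx, P (k i) -> g k = 0).
  elim: s hs iNs {Tf} => //= l s IH; rewrite !inE !negb_or ![_ == l]eq_sym.
  move=> /andP[lh hs] /andP[li iNs] gN; rewrite -IH //; split => Hg.
    apply: (@shiftX_vanish (fun k => P (k i)) l) => //; first exact: truncated_shiftXs.
    by move=> k j Pk; left; rewrite step_idxm // eq_sym.
  move=> k Pk; rewrite /shiftX big1 // => j _.
  by rewrite Hg ?scaler0 // step_idxm // eq_sym.
apply/(slice (fun a => a < 0)) => //.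
apply: (@shiftX_vanish (fun k => k i < 0) i) => //; first exact: truncated_shiftXs.
move=> k j ki; rewrite step_idxl //.
have [odd_k|even_k] := boolP (oddz (k i)).
  right; rewrite (proj2 (slice oddz f fN) fo) ?scaler0 // step_idxl //.
  by move: odd_k; rewrite /oddz; lia.
case: (ltP (k i + 2 * j.+1%:Z) 0) => [|kj]; [by left|right].
have [m em mj] : exists2 m : nat, k i + 2 * j.+1%:Z = 2 * m%:Z & (m < j.+1)%N.
  by exists (`|(k i + 2 * j.+1%:Z)%R| %/ 2)%N; move: even_k kj; rewrite /oddz; lia.
by rewrite em halfz_even -pmulrn gbinom_small ?scale0r.
Qed.

End Shift.
End Formal.

(** * Weights and associativity *)

Section Coproducts.
Variables (K : numFieldType) (J : choiceType) (U : lmodType K) (S : J -> set U).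
Hypothesis Scop : is_coproduct S.

Lemma coproduct_decomp u : exists (c : J -> U) (s : seq J),
  (forall j, S j (c j)) /\ u = \sum_(j <- s) c j.
Proof.
have [_ /(_ u)[c [[cS cfin ->] _]]] := Scop.
exists c, (fset_set [set i | c i != 0]%classic); split => //.
apply: fsbigTE => i; rewrite in_fset_set // mem_setE => /negP ci.
by apply/eqP/negPn/negP.
Qed.

(** Applying d - lam_j to the decomposition of u gives a decomposition of 0. By uniqueness its
    components (lam_i - lam_j) c_i vanish, so only c_j survives. Weights can thus be read off from
    eigenvalues. *)
Lemma coproduct_eigen (d : {linear U -> U}) (lam : J -> K) :
  injective lam -> (forall j u, S j u -> d u = lam j *: u) ->
  forall j u, d u = lam j *: u -> S j u.
Proof.
move=> laminj dS j u du; have [Ssub Sdec] := Scop.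
have [c [[cS cfin uE] _]] := Sdec u.
pose s := fset_set [set i | c i != 0]%classic.
have c0 i : i \notin s -> c i = 0.
  rewrite in_fset_set // mem_setE => /negP ci.
  by apply/eqP/negPn/negP.
have us : u = \sum_(i <- s) c i by rewrite uE; apply: fsbigTE.
have e0 : \sum_(i <- s) (lam i - lam j) *: c i = 0.
  under eq_bigr do rewrite scalerBl.
  rewrite sumrB -scaler_sumr -us -du {1}us linear_sum /=.
  by apply/eqP; rewrite subr_eq0; apply/eqP/eq_bigr => i _; rewrite (dS i).
have [c' [_ c'u]] := Sdec 0.
have ce : (fun i => (lam i - lam j) *: c i) = (fun=> 0).
  transitivity c'; [apply/esym/c'u|apply/c'u]; split.
  - move=> i; have [S0 SZ] := Ssub i.
    by have := SZ (lam i - lam j) (c i) 0 (cS i) S0; rewrite addr0.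
  - by apply: (sub_finite_set _ cfin) => i /=; apply: contra => /eqP ->; rewrite scaler0.
  - rewrite -[LHS]e0; apply/esym/fsbigTE => i /c0 ->; exact: scaler0.
  - by move=> i; case: (Ssub i).
  - by apply: (sub_finite_set _ (@finite_set0 J)) => i /=; rewrite eqxx.
  - by rewrite fsbig1.
suff -> : u = c j by [].
rewrite us; have cn i : i != j -> c i = 0.
  move=> ij; have /eqP := congr1 (fun F => F i) ce; rewrite /= scaler_eq0 subr_eq0.
  by case/orP => [/eqP/laminj ei|/eqP //]; rewrite ei eqxx in ij.
have [js|js] := boolP (j \in s); last first.
  rewrite (c0 j) // big1_seq // => i /andP[_ is_]; rewrite cn //.
  by apply: contraNneq js => <-.
by rewrite (bigD1_seq j) ?fset_uniq //= big1 ?addr0 // => i /cn.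
Qed.

End Coproducts.

Section Weights.
Context (R : realType) (V : lmodType R[i]) (A : mosva V).
Local Notation C := R[i].

Lemma halfz_inj : injective (half : int -> C).
Proof.
move=> a b /(congr1 ( *%R^~ 2)); rewrite /half !mulfVK ?pnatr_eq0 //.
exact: intr_inj.
Qed.

Lemma fmulx_fderiv (W : lmodType C) (f : int -> W) k :
  fmulx (fderiv f) k = half k *: f k.
Proof. by rewrite /fmulx /fderiv subrK. Qed.

Lemma wt_VE k v : wt_V A k v <-> d_V A v = half k *: v.
Proof.
split; first exact: d_V_wt.
exact: (coproduct_eigen (wt_V_coproduct A) halfz_inj (@d_V_wt _ _ A)).
Qed.

Lemma wt_V_vacuum : wt_V A 0 (vacuum A).
Proof.
apply/wt_VE; rewrite /half mul0r scale0r.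
(* On the vacuum, at exponent 0, the bracket reads 0 = Y_0(d 1) 1, and the right-hand side is d 1 by
   the creation property. *)
have := d_V_bracket A 0 (vacuum A) (vacuum A).
rewrite fmulx_fderiv /half mul0r scale0r addr0 !Y_V_vacuum eqxx subrr.
by rewrite (proj2 (Y_V_creation A _)).
Qed.

Lemma wt_V_Y a b k u v : wt_V A a u -> wt_V A b v ->
  wt_V A (k + a + b) (Y_V A k u v).
Proof.
move=> /d_V_wt du /d_V_wt dv; apply/wt_VE.
have /eqP := d_V_bracket A k u v; rewrite subr_eq => /eqP ->.
rewrite fmulx_fderiv dv du linearZr_LR linearZl_LR /= !halfz_D !scalerDl.
by congr (_ + _); exact: addrC.
Qed.

Lemma wt_V_low : exists N : int, forall k v, wt_V A k v -> k < N -> v = 0.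
Proof.
have [N HN] := wt_V_bounded A; exists N => k v kv kN.
by have := HN k kN v kv.
Qed.

Context (theta : involution A) (W : lmodType C) (M : twisted_module theta W).

Lemma wt_W_Y a m k u w : wt_V A a u -> wt_W M m w ->
  wt_W M (m + half (k + a)) (Y_W M k u w).
Proof.
move=> /d_V_wt du /d_W_wt dw.
apply: (coproduct_eigen (wt_W_coproduct M) (@inj_id _) (@d_W_wt _ _ _ _ _ M)).
have /eqP := d_W_bracket M k u w; rewrite subr_eq => /eqP ->.
rewrite fmulx_fderiv dw du linearZr_LR linearZl_LR /= !halfz_D !scalerDl.
by rewrite addrC; congr (_ + _); exact: addrC.
Qed.

End Weights.

Section AssocModules.
Context (R : realType) (V : lmodType R[i]) (A : mosva V).
Local Notation C := R[i].

(* What V, as a module over itself, and the twisted modules have in common. *)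
Definition assoc_module (W : lmodType C) (Y : int -> {bilinear V -> W -> W}) :=
  (forall a v w, wt_V A a v -> exists N : int, forall k, k < N -> Y k v w = 0) /\
  (forall a v w, wt_V A a v -> exists r : nat,
     (forall k x, oddz (k - r%:Z) -> Y k v x = 0) /\
     forall b u, wt_V A b u ->
       product_series Y r%:Z 0 v u w = iterate_series (Y_V A) Y r%:Z 0 v u w).

(** The weight of the coefficient decreases with k, while the weights of V are bounded below; w is
    first split into its homogeneous components. *)
Lemma Y_V_truncated a v w : wt_V A a v ->
  exists N : int, forall k, k < N -> Y_V A k v w = 0.
Proof.
move=> av; have [c [s [cS ->]]] := coproduct_decomp (wt_V_coproduct A) w.
have [N0 HN0] := wt_V_low A.
elim: s => [|j s [N IH]]; first by exists 0 => k _; rewrite big_nil linear0r.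
exists (Num.min N (N0 - a - j)) => k kN; rewrite big_cons linearDr IH ?addr0; last by lia.
by apply: (HN0 _ _ (wt_V_Y k av (cS j))); lia.
Qed.

Lemma assoc_module_V : assoc_module (Y_V A).
Proof.
split; first exact: Y_V_truncated.
move=> a v w _; have [P HP] := Y_V_assoc A v w; exists (2 * P)%N; split.
  by move=> k x ok; apply: Y_V_integral; move: ok; rewrite /oddz; lia.
by move=> b u _; rewrite PoszM; exact: HP.
Qed.

(* Associativity with the vacuum as second vector. *)
Lemma Y_W_support (theta : involution A) (W : lmodType C)
    (M : twisted_module theta W) v e w : homogeneous A v e ->
  exists N : int, forall k, Y_W M k v w != 0 -> oddz k = e /\ N <= k.
Proof.
have vac : homogeneous A (vacuum A) false by exists 0 => //; exact: wt_V_vacuum.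
move=> /(Y_W_assoc M w)[P /(_ _ _ vac)[[N HN] _ _]]; pose r := 2 * P%:Z + e%:Z.
exists (N - r) => k Yk; have := HN (k + r) 0.
(* At exponent 0 of x2 only j = 0 contributes, the other coefficients of Y(1, x2) being zero. What
   remains is [Y_W M k v w], so the Laurent condition bears on it directly. *)
rewrite /product_series (@fsum_nat _ _ 1); last first.
  by move=> j j0; rewrite Y_W_vacuum ifF ?linear0r ?scaler0 //; lia.
rewrite big_ord1 gbinom0 scale1r Y_W_vacuum /= mulr0 !subr0 addrK.
by case/(_ Yk); rewrite /r /oddz; case: (e) => /=; lia.
Qed.

Lemma assoc_module_W (theta : involution A) (W : lmodType C)
  (M : twisted_module theta W) : assoc_module (Y_W M).
Proof.
split=> a v w av; have hv : homogeneous A v (oddz a) by exists a.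
  have [N HN] := Y_W_support M w hv.
  by exists N => k kN; apply/eqP/negPn/negP => /HN[_]; lia.
(* The parity of v is absorbed in the doubled exponent of x0 + x2, so that this power makes all
   exponents even. *)
have [P HP] := Y_W_assoc M w hv; exists (2 * P + oddz a)%N; split.
  move=> k x; have [N HN] := Y_W_support M x hv.
  by apply: contraTeq => /HN[+ _]; rewrite /oddz; lia.
move=> b u bu; have hu : homogeneous A u (oddz b) by exists b.
have [_ _ PI] := HP u _ hu.
rewrite PoszD PoszM; apply/funext => x; apply/funext => y.
(* The factor x2^(|u|/2), common to both sides, is a mere shift of the second exponent. *)
transitivity (product_series (Y_W M) (2 * P%:Z + (oddz a)%:Z) (oddz b)%:Z v u w x (y + (oddz b)%:Z)).
  by apply: eq_fsbigr => j _; congr (_ *: Y_W M _ _ (Y_W M _ _ _)); lia.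
rewrite PI; apply: eq_fsbigr => j _; congr (_ *: Y_W M _ _ _); lia.
Qed.

End AssocModules.

(** * Iterated associativity *)

Lemma eventually_ord (P : nat -> nat -> Prop) (m : nat) :
  (forall j, exists n0, forall n, (n0 <= n)%N -> P j n) ->
  exists n0, forall n, (n0 <= n)%N -> forall j, (j < m)%N -> P j n.
Proof.
move=> HP; elim: m => [|m [n1 H1]]; first by exists 0%N.
have [n2 H2] := HP m; exists (maxn n1 n2) => n; rewrite geq_max => /andP[n1n n2n] j.
by rewrite ltnS leq_eqVlt => /orP[/eqP ->|]; [exact: H2|exact: H1].
Qed.

(** * Multiplication by cut-off binomial series *)

Section Ball.
Variables (K : numFieldType) (I : finType) (U : lmodType K).
Variables (h : I) (r : I -> nat) (J : nat).
Local Notation idx := {ffun I -> int}.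
Implicit Types (f : idx -> U) (k : idx).

Definition single (i : I) (n : int) : idx := [ffun j => if j == i then n else 0].

Lemma singleE i n j : single i n j = if j == i then n else 0.
Proof. by rewrite ffunE. Qed.

(* Multiplication by (x_h + x_i)^(r_i/2), expanded in nonnegative powers of
   x_i and cut off at x_i^J; cutting off makes it a finite combination of
   translations. *)
Definition binX (i : I) f : idx -> U := fun k =>
  \sum_(j < J) gbinom (half (r i)%:Z) j *:
    f (k - (dbl i - dbl h) *+ j - single h (r i)%:Z).

(** A left fold: the head of [t] acts first, which is the order produced by the induction in
    [shiftXs_prodG]. *)
Definition binXs (t : seq I) f := foldl (fun g i => binX i g) f t.

Lemma binX_idx i k j m : m != h -> i != h ->
  (k - (dbl i - dbl h) *+ j - single h (r i)%:Z) m = if m == i then k i - 2 * j%:Z else k m.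
Proof.
by move=> mh ih; rewrite !idxE singleE (negbTE mh); case: eqP => [->|_] /=; lia.
Qed.

Lemma binXs_translate t f a k :
  binXs t (fun k => f (k + a)) k = binXs t f (k + a).
Proof.
elim: t f => //= i t IH f; rewrite -IH; congr (binXs t _ k).
apply/funext => k'; apply: eq_bigr => j _.
by rewrite -!addrA ![a + _]addrC !addrA.
Qed.

Lemma binXsD t f g k : binXs t (fun k => f k + g k) k = binXs t f k + binXs t g k.
Proof.
elim: t f g => //= i t IH f g; rewrite -IH; congr (binXs t _ k).
apply/funext => k'; rewrite /binX -big_split; apply: eq_bigr => j _; exact: scalerDr.
Qed.

Lemma binXsB t f g k : binXs t (fun k => f k - g k) k = binXs t f k - binXs t g k.
Proof.
elim: t f g => //= i t IH f g; rewrite -IH; congr (binXs t _ k).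
apply/funext => k'; rewrite /binX -sumrB; apply: eq_bigr => j _; exact: scalerBr.
Qed.

Lemma binXs0 t k : binXs t (fun=> 0 : U) k = 0.
Proof. elim: t => //= i t IH; rewrite -[RHS]IH; congr (binXs t _ k).
by apply/funext => k'; rewrite /binX big1 // => j _; rewrite scaler0. Qed.

Lemma binXs_sum (T : Type) (s : seq T) t (f : T -> idx -> U) k :
  binXs t (fun k => \sum_(i <- s) f i k) k = \sum_(i <- s) binXs t (f i) k.
Proof.
elim: s => [|i s IH]; first by under eq_fun do rewrite big_nil; rewrite big_nil binXs0.
by rewrite big_cons -IH -binXsD; under eq_fun do rewrite big_cons.
Qed.

Lemma binXs_lin i t (L : int -> {linear U -> U}) f k : i != h -> i \notin t -> h \notin t ->
  binXs t (fun k => L (k i) (f k)) k = L (k i) (binXs t f k).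
Proof.
move=> ih; elim: t f => //= l t IH f; rewrite !inE !negb_or => /andP[il it] /andP[hl ht].
rewrite eq_sym in hl; rewrite -IH //; congr (binXs t _ k); apply/funext => k'.
rewrite linear_sum; apply: eq_bigr => j _; rewrite linearZ /=; congr (_ *: L _ _).
by rewrite binX_idx // (negbTE il).
Qed.

Lemma binXs_mulD t i j f : binXs t (mulD i j f) = mulD i j (binXs t f).
Proof. by apply/funext => k; rewrite binXsB !binXs_translate. Qed.

(** A coefficient of [binXs t g] involves finitely many coefficients of g, at exponents that away
    from h are not larger than the original ones. Pointwise stabilization there is therefore
    enough. *)
Lemma binXs_eventually t (f : nat -> idx -> U) g k : h \notin t ->
  (forall k', (forall m, m != h -> k' m <= k m) ->
     exists n0, forall n, (n0 <= n)%N -> f n k' = g k') ->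
  exists n0, forall n, (n0 <= n)%N -> binXs t (f n) k = binXs t g k.
Proof.
elim: t f g => [|i t IH] f g /=; first by move=> _ /(_ k); apply.
rewrite inE negb_or => /andP[hi ht] fg.
apply: IH => // k' k'k.
pose P j n := f n (k' - (dbl i - dbl h) *+ j - single h (r i)%:Z)
  = g (k' - (dbl i - dbl h) *+ j - single h (r i)%:Z).
have [n0 Hn0] : exists n0, forall n, (n0 <= n)%N -> forall j, (j < J)%N -> P j n.
  apply: eventually_ord => j; apply: fg => m mh.
  rewrite eq_sym in hi; rewrite binX_idx //; case: eqP => [->|_]; last exact: k'k.
  by have := k'k i hi; lia.
by exists n0 => n nn; apply: eq_bigr => j _; rewrite (Hn0 n nn j).
Qed.

Lemma eq_binXs t f g k : h \notin t ->
  (forall k', (forall m, m != h -> k' m <= k m) -> f k' = g k') ->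
  binXs t f k = binXs t g k.
Proof.
move=> ht fg; have [n H] : exists n0 : nat, forall n, (n0 <= n)%N -> binXs t f k = binXs t g k.
  by apply: (@binXs_eventually _ (fun=> f)) => // k' /fg ->; exists 0%N.
exact: (H n).
Qed.

End Ball.

Section Products.
Context (R : realType) (V : lmodType R[i]) (I : finType).
Local Notation C := R[i].
Local Notation idx := {ffun I -> int}.

Definition prodY (W : lmodType C) (Y : int -> {bilinear V -> W -> W})
  (v : I -> V) (s : seq I) (w : W) : idx -> W :=
  fun k => foldr (fun i x => Y (k i) (v i) x) w s.

Lemma eq_prodY (W : lmodType C) (Y : int -> {bilinear V -> W -> W}) v s w (k k' : idx) :
  {in s, k =1 k'} -> prodY Y v s w k = prodY Y v s w k'.
Proof.
rewrite /prodY; elim: s => //= i s IH kk'; rewrite kk' ?mem_head // IH // => j js.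
by apply: kk'; rewrite inE js orbT.
Qed.

Variables (A : mosva V) (v : I -> V) (a : I -> int).
Hypothesis av : forall i, wt_V A (a i) (v i).

Lemma wt_prodY s h (k : idx) :
  wt_V A (\sum_(i <- s) (k i + a i) + a h) (prodY (Y_V A) v s (v h) k).
Proof.
elim: s => [|i s IH]; first by rewrite big_nil add0r.
by rewrite big_cons -addrA; exact: wt_V_Y.
Qed.

(** The weight of this vector is a sum of exponents and constants, hence bounded above in terms of
    c, and 2j eventually pushes it below all weights of V. The uniformity in [i] and [k] is what
    permits one cutoff [J] in [binX]. *)
Lemma prodY_V_low (t : seq I) h (c : int) : exists m : nat, forall i (k : idx) j,
  (forall l, l \in i :: t -> k l <= c) -> (m <= j)%N ->
  Y_V A (k i - 2 * j%:Z) (v i) (prodY (Y_V A) v t (v h) k) = 0.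
Proof.
have [N HN] := wt_V_low A.
have sum_le (s : seq I) (k : idx) : (forall l, l \in s -> k l <= c) ->
    \sum_(i <- s) (k i + a i) <= \sum_(i <- s) (c + a i).
  move=> kc; rewrite big_seq [leRHS]big_seq; apply: ler_sum => l /kc; lia.
(* An upper bound for the weight at j = 0; the last sum bounds [a i] uniformly in i. *)
pose b := c + \sum_(l <- t) (c + a l) + a h + \sum_i `|a i|.
exists `|b - N|.+1 => i k j kc mj; apply: (HN _ _ (wt_V_Y _ (av i) (wt_prodY t h k))).
have := sum_le t k (fun l lt => kc l (@mem_behead _ (i :: t) l lt)); have := kc i (mem_head _ _).
have : `|a i| <= \sum_i `|a i| by rewrite (bigD1 i) //= lerDl sumr_ge0.
move: mj; rewrite /b; move: (\sum_(l <- t) (k l + a l)) (\sum_(l <- t) (c + a l)) (\sum_i `|a i|).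
move: (k i) (a i) (a h) {kc} => ki ai ah x y z; lia.
Qed.

Section Module.
Variables (W : lmodType C) (Y : int -> {bilinear V -> W -> W}).
Hypothesis YW : assoc_module A Y.
Variables (w : W) (h : I) (r : I -> nat).
Hypothesis r_assoc : forall i b u, wt_V A b u ->
  product_series Y (r i)%:Z 0 (v i) u w = iterate_series (Y_V A) Y (r i)%:Z 0 (v i) u w.
Variable N : int.
Hypothesis vhN : forall k, k < N -> Y k (v h) w = 0.

(* The two sides of iterated associativity, the left-hand one before the
   substitution and the right-hand one without its binomial factors. *)
Definition prodG (t : seq I) : idx -> W := fun k =>
  foldr (fun i x => Y (k i - (r i)%:Z) (v i) x) (Y (k h) (v h) w) t.

Definition iterG (t : seq I) : idx -> W := fun k =>
  Y (k h) (prodY (Y_V A) v t (v h) k) w.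

Lemma truncated_prodG t : truncated N h (prodG t).
Proof. by move=> k /vhN kN; elim: t => //= i t ->; rewrite linear0r. Qed.

Lemma shiftXs_lin i t (L : int -> {linear W -> W}) (f : idx -> W) k :
  i != h -> i \notin t -> h \notin t ->
  shiftXs N h t (fun k => L (k i) (f k)) k = L (k i) (shiftXs N h t f k).
Proof.
move=> ih; elim: t k => //= l t IH k; rewrite !inE !negb_or => /andP[il it] /andP[hl ht].
rewrite /shiftX linear_sum; apply: eq_bigr => j _; rewrite linearZ IH //=.
by rewrite step_idxm // eq_sym.
Qed.

(** By induction, the variables of the tail are first gathered into one vector of V acting on w.
    Weak associativity then applies to [v i] and that vector with the order [r i], which is the same
    for every second vector. The bound c on the exponents makes the cutoff uniform. *)
Lemma shiftXs_prodG t (c : int) : uniq t -> h \notin t ->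
  exists J0, forall J, (J0 <= J)%N -> forall k : idx, (forall i, i \in t -> k i <= c) ->
    shiftXs N h t (prodG t) k = binXs h r J t (iterG t) k.
Proof.
elim: t => [|i t IH] /=; first by exists 0%N.
rewrite inE negb_or eq_sym => /andP[it ut] /andP[ih ht].
have [J1 HJ1] := IH ut ht; have [J2 HJ2] := prodY_V_low t h c.
exists (maxn J1 J2) => J; rewrite geq_max => /andP[J1J J2J] k kc.
pose L a0 : {linear W -> W} := Y (a0 - (r i)%:Z) (v i).
(* The first n terms of the product side of associativity for [v i] and the gathered vector. *)
pose F n (k' : idx) := \sum_(j < n) gbinom (half (k' i + 2 * j%:Z)) j *:
   L (k' i + 2 * j%:Z) (iterG t (k' + (dbl i - dbl h) *+ j)).
have Fn n : k h - 2 * n%:Z < N -> shiftX N h i (shiftXs N h t (prodG (i :: t))) k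
    = binXs h r J t (F n) k.
  move=> kn; rewrite (@shiftXE _ _ _ _ _ _ _ _ n) //; last first.
    by apply: truncated_shiftXs => //; exact: truncated_prodG.
  rewrite binXs_sum; apply: eq_bigr => j _.
  rewrite (@shiftXs_lin i t L (prodG t)) // step_idxl //.
  rewrite (HJ1 _ J1J); last first.
    move=> l lt; rewrite step_idxm //; first by apply: kc; rewrite inE lt orbT.
      by apply: contraNneq it => <-.
    by apply: contraNneq ht => <-.
  have := @binXs_lin _ _ _ h r J i t (fun b => gbinom (half (b + 2 * j%:Z)) j \*: L (b + 2 * j%:Z))
    (fun k' => iterG t (k' + (dbl i - dbl h) *+ j)) k ih it ht.
  by rewrite /= => ->; rewrite binXs_translate.
(* At each exponent [F n] stabilizes, by lower truncation, to the product series, hence to the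
   iterate series. *)
have [n0 Hn0] : exists n0, forall n, (n0 <= n)%N ->
    binXs h r J t (F n) k = binXs h r J t (binX h r J i (iterG (i :: t))) k.
  apply: binXs_eventually => // k' k'k.
  have k'c l : l \in i :: t -> k' l <= c.
    move=> lt; apply: le_trans (kc l lt); apply: k'k.
    by apply: contraTneq lt => ->; rewrite inE negb_or eq_sym ih.
  have [N' HN'] := YW.1 _ _ w (wt_prodY t h k').
  exists `|k' h - N'|.+1 => n nn.
  have itG j l m : m \in t -> (k' + (dbl i - dbl h) *+ j - (dbl i - dbl h) *+ l) m = k' m.
    move=> mt; have mi : m != i by apply: contraNneq it => <-.
    have mh : m != h by apply: contraNneq ht => <-.
    by rewrite !idxE (negbTE mi) (negbTE mh) /=; lia.
  transitivity (product_series Y (r i)%:Z 0 (v i) (prodY (Y_V A) v t (v h) k') w (k' i) (k' h)).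
    rewrite /product_series (@fsum_nat _ _ n); last first.
      by move=> j nj; rewrite HN' ?linear0r ?scaler0 //; lia.
    apply: eq_bigr => j _; congr (_ *: Y _ _ _); rewrite /iterG step_idx // subr0.
    congr (Y _ _ _); apply: eq_prodY => m mt.
    by have := itG j 0%N m mt; rewrite mulr0n subr0.
  (* On the iterate side the powers of x_i beyond the cutoff [J] contribute nothing, by
     [prodY_V_low]. *)
  rewrite (r_assoc i (wt_prodY t h k')) /iterate_series (@fsum_nat _ _ J); last first.
    move=> j Jj; rewrite HJ2 ?linear0r ?linear0l ?scaler0 //; exact: leq_trans Jj.
  apply: eq_bigr => j _; congr (_ *: _); rewrite /iterG.
  have -> : (k' - (dbl i - dbl h) *+ j - single h (r i)%:Z) h = k' h - 0 - ((r i)%:Z - 2 * j%:Z).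
    by rewrite !idxE singleE eqxx eq_sym (negbTE ih) /=; lia.
  congr (Y _ _ _); rewrite /= binX_idx // eqxx; congr (Y_V A _ _ _).
  apply: eq_prodY => m mt; rewrite binX_idx //.
    by rewrite ifN //; apply: contraNneq it => <-.
  by apply: contraNneq ht => <-.
have kn : k h - 2 * (maxn n0 `|k h - N|.+1)%:Z < N by lia.
by rewrite (Fn _ kn) (Hn0 _ (leq_maxl _ _)).
Qed.

End Module.
End Products.

(** * Poles in the leftmost variable *)

Section Leftmost.
Context (R : realType) (V : lmodType R[i]) (I : finType) (A : mosva V).
Local Notation C := R[i].
Local Notation idx := {ffun I -> int}.
Variables (v : I -> V) (a : I -> int).
Hypothesis av : forall i, wt_V A (a i) (v i).

Lemma leftmost1 (W : lmodType C) (Y : int -> {bilinear V -> W -> W}) lo w :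
  assoc_module A Y ->
  exists (q : nat) (Q : I -> nat), forall k : idx, k lo < - q%:Z ->
    mulDs lo Q [::] (prodY Y v [:: lo] w) k = 0.
Proof.
case=> YN _; have [N HN] := YN _ _ w (av lo).
exists `|N|%N, (fun=> 0%N) => k kq; apply: HN; lia.
Qed.

(** After the substitution x_l + x_h, all vectors but [v h] act on [v h] inside V, where the poles
    in x_lo are under control by hypothesis. The order q of the pole at x_lo = 0 becomes the
    exponent of the new factor x_lo - x_h, and the other factors are unchanged. *)
Lemma leftmost_step (W : lmodType C) (Y : int -> {bilinear V -> W -> W}) lo t h w :
  assoc_module A Y -> uniq (lo :: rcons t h) ->
  (exists (q : nat) (Q : I -> nat), forall k : idx, k lo < - q%:Z ->
    mulDs lo Q t (prodY (Y_V A) v (lo :: t) (v h)) k = 0) ->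
  exists (q : nat) (Q : I -> nat), forall k : idx, k lo < - q%:Z ->
    mulDs lo Q (rcons t h) (prodY Y v (lo :: rcons t h) w) k = 0.
Proof.
move=> YW; rewrite /= mem_rcons inE negb_or rcons_uniq => /andP[/andP[loh lot] /andP[ht ut]].
case=> q [Q HQ].
have /choice[r Hr] : forall i, exists r : nat,
     (forall k x, oddz (k - r%:Z) -> Y k (v i) x = 0) /\
     forall b u, wt_V A b u ->
       product_series Y r%:Z 0 (v i) u w = iterate_series (Y_V A) Y r%:Z 0 (v i) u w.
  by move=> i; apply: YW.2 (av i).
have [N HN] := YW.1 _ _ w (av h).
pose s := lo :: t; have us : uniq s by rewrite /= lot ut.
have hs : h \notin s by rewrite inE negb_or eq_sym loh.
have los : lo \in s by rewrite mem_head.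
have r_assoc i := (Hr i).2.
pose G := prodG v Y w h r s.
have GN : truncated N h G by apply: truncated_prodG.
pose Q' j := if j == h then q else Q j.
pose f := mulDs lo Q' (rcons t h) G.
have fE : f = mulDs lo Q t (iter q (mulD lo h) G).
  have Qh : Q' h = q by rewrite /Q' eqxx.
  rewrite /f mulDs_rcons Qh; apply: eq_mulDs => j jt.
  by rewrite /Q' ifN //; apply: contraNneq ht => <-.
have sf : truncated N h f /\
    shiftXs N h s f = mulDs lo Q t (iter q (mulX lo) (shiftXs N h s G)).
  rewrite fE; pose P (g g' : idx -> W) := truncated N h g /\ shiftXs N h s g = g'.
  apply: (@mulDs_rel _ _ _ P) => [j g g' jt [gN <-]|].
    split; first exact: truncated_mulD.
    by rewrite shiftXs_mulD // inE jt orbT.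
  elim: (q) => [|n [gN gE]]; first by split.
  rewrite /P !iterS; split; first exact: truncated_mulD.
  by rewrite shiftXs_mulDh // gE.
(* The shift by [r lo] built into [prodG] makes the exponents of x_lo integral, as [shiftXs_reflect]
   requires. *)
have f_odd (k : idx) : oddz (k lo) -> f k = 0.
  move: k; rewrite fE; pose P (g : idx -> W) := forall k : idx, oddz (k lo) -> g k = 0.
  have PD j g : P g -> P (mulD lo j g).
    by move=> Pg k kodd; rewrite /mulD /mulX !Pg ?subrr // oddz_dbl.
  apply: (@mulDs_ind _ _ P) => [j g jt|]; first exact: PD.
  elim: (q) => [|n IH] /=; last exact: PD.
  by move=> k kodd; rewrite /G /= (Hr lo).1 //; move: kodd; rewrite /oddz; lia.
(* It suffices to exclude negative powers of x_lo after the substitution. *)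
have f0 (k : idx) : k lo < 0 -> f k = 0.
  move: k; apply: (@shiftXs_reflect _ _ _ N h lo t) => //; first exact: sf.1.
  move=> k klo; rewrite sf.2.
  (* With [k] fixed, the multiplications only read smaller exponents in [s], so one bound c and its
     cutoff [J] serve throughout. *)
  have [c Hc] : exists c : int, forall i, k i <= c.
    exists (\sum_i `|k i|) => i; rewrite (bigD1 i) //=.
    by apply: le_trans (ler_norm _) _; rewrite lerDl sumr_ge0.
  have [J HJ] := shiftXs_prodG av YW r_assoc HN c us hs.
  have kle0 (k' : idx) m : k' m <= k m -> k' m <= c by move=> k'k; apply: le_trans (Hc m).
  pose P (g g' : idx -> W) := forall k' : idx, (forall i, i \in s -> k' i <= k i) -> g k' = g' k'.
  have PD i (g g' : idx -> W) : P g g' -> P (mulX i g) (mulX i g').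
    move=> Pg k' k'k; apply: Pg => l ls; rewrite !idxE; have := k'k l ls.
    by case: eqP => _; lia.
  have PB : P (mulDs lo Q t (iter q (mulX lo) (shiftXs N h s G)))
              (mulDs lo Q t (iter q (mulX lo) (binXs h r J s (iterG A v Y w h s)))).
    apply: (@mulDs_rel _ _ _ P) => [j g g' jt Pg k' k'k|].
      by rewrite /mulD !(PD _ _ _ Pg).
    elim: (q) => [|n IH]; last by rewrite !iterS; exact: PD.
    by move=> k' k'k; apply: HJ => // i ls; apply: kle0; exact: k'k.
  rewrite PB //.
  (* Cut-off binomial factors are finite combinations of translations, with which multiplications
     commute. *)
  have -> : mulDs lo Q t (iter q (mulX lo) (binXs h r J s (iterG A v Y w h s)))
     = binXs h r J s (mulDs lo Q t (iter q (mulX lo) (iterG A v Y w h s))).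
    pose P' (g g' : idx -> W) := g = binXs h r J s g'.
    apply: (@mulDs_rel _ _ _ P') => [j g g' jt ->|].
      by rewrite /P' binXs_mulD.
    elim: (q) => [//|n IH] /=.
    by rewrite IH /P'; apply/funext => k'; rewrite [RHS]binXs_translate.
  rewrite (@eq_binXs _ _ _ _ _ _ _ _ (fun=> 0)) ?binXs0 // => k' k'k.
  have -> : mulDs lo Q t (iter q (mulX lo) (iterG A v Y w h s)) k'
     = Y (k' h) (mulDs lo Q t (iter q (mulX lo) (prodY (Y_V A) v s (v h))) k') w.
    pose P' (g : idx -> W) (g' : idx -> V) := forall k' : idx, g k' = Y (k' h) (g' k') w.
    have P'X i g g' : i != h -> P' g g' -> P' (mulX i g) (mulX i g').
      by move=> ih Pg k1; rewrite /mulX Pg idxB dblE eq_sym (negbTE ih) subr0.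
    move: k' {k'k}; apply: (@mulDs_rel _ _ _ P') => [j g g' jt Pg k1|].
      rewrite /mulD !(P'X _ _ _ _ Pg) ?linearBl //.
      by apply: contraNneq ht => <-.
    by elim: (q) => [//|n IH] /=; apply: P'X.
  have -> : mulDs lo Q t (iter q (mulX lo) (prodY (Y_V A) v s (v h))) k'
     = mulDs lo Q t (prodY (Y_V A) v s (v h)) (k' - dbl lo *+ q).
    pose P' (g g' : idx -> V) := forall k' : idx, g k' = g' (k' - dbl lo *+ q).
    move: k' {k'k}; apply: (@mulDs_rel _ _ _ P') => [j g g' jt Pg k1|k1].
      by rewrite /mulD /mulX !Pg -!addrA ![- _ - dbl lo *+ q]addrC.
    exact: iter_mulX.
  (* Multiplication by x_lo^q lowers the doubled exponent by 2q, so a negative exponent falls below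
     -q. *)
  rewrite HQ ?linear0l //.
  by rewrite !idxE eqxx; have := k'k lo loh; move: klo; lia.
(* Translation by [rho] undoes the shifts by [r] in [prodG]; this is where the pole order [r lo] at
   x_lo = 0 comes from. *)
pose rho : idx := [ffun i => if i == h then 0 else (r i)%:Z].
exists (r lo), Q' => k klo.
have <- : f (k + rho) = mulDs lo Q' (rcons t h) (prodY Y v (lo :: rcons t h) w) k.
  pose P (g g' : idx -> W) := forall k : idx, g (k + rho) = g' k.
  rewrite /f; move: k {klo}; apply: (@mulDs_rel _ _ _ P) => [j g g' _ Pg k|k].
    by rewrite /mulD /mulX -!Pg ![k - _ + rho]addrAC.
  rewrite /G /prodG /prodY -rcons_cons -/s foldr_rcons idxD ffunE eqxx addr0.
  elim: s hs {us los GN f_odd sf f f0 fE G} => //= i s IH.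
  rewrite inE negb_or eq_sym => /andP[ih hs]; rewrite IH //.
  by rewrite idxD ffunE (negbTE ih) addrK.
by apply: f0; rewrite idxD ffunE (negbTE loh); lia.
Qed.

Lemma leftmost_V lo s w : uniq (lo :: s) ->
  exists (q : nat) (Q : I -> nat), forall k : idx, k lo < - q%:Z ->
    mulDs lo Q s (prodY (Y_V A) v (lo :: s) w) k = 0.
Proof.
have YV := assoc_module_V A.
elim/last_ind: s w => [|t h IH] w us; first exact: leftmost1.
apply: leftmost_step => //; apply: IH.
by move: us; rewrite -rcons_cons rcons_uniq => /andP[].
Qed.

(** One step suffices for any module, because the inner product it leaves lies in V. *)
Lemma leftmost (W : lmodType C) (Y : int -> {bilinear V -> W -> W}) lo s w :
  assoc_module A Y -> uniq (lo :: s) ->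
  exists (q : nat) (Q : I -> nat), forall k : idx, k lo < - q%:Z ->
    mulDs lo Q s (prodY Y v (lo :: s) w) k = 0.
Proof.
move=> YW; elim/last_ind: s => [|t h _] us; first exact: leftmost1.
apply: leftmost_step => //; apply: leftmost_V.
by move: us; rewrite -rcons_cons rcons_uniq => /andP[].
Qed.

End Leftmost.

(** * Absolute convergence *)

Section AbsoluteConvergence.
Context {R : realType}.
Local Notation C := R[i].
Local Notation normc := Normc.normc.

Lemma normc_ge0 (z : C) : 0 <= normc z.
Proof. by case: z => a b; rewrite /normc sqrtr_ge0. Qed.

Lemma normcD (x y : C) : normc (x + y) <= normc x + normc y.
Proof. exact: le_normcD. Qed.

Lemma normcB (x y : C) : normc (x - y) <= normc x + normc y.
Proof. by apply: le_trans (normcD _ _) _; rewrite [normc (- y)]normcN. Qed.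

Lemma normc_sum (T : Type) (s : seq T) (f : T -> C) :
  normc (\sum_(i <- s) f i) <= \sum_(i <- s) normc (f i).
Proof.
elim: s => [|i s IH]; first by rewrite !big_nil Normc.normc0.
by rewrite !big_cons; apply: le_trans (normcD _ _) _; rewrite lerD2l.
Qed.

Variable T : choiceType.
Implicit Types (t : T -> C) (l : C) (F : {fset T}).

Lemma summable_bounded t :
  summable [set: T]%classic (fun i => (normc (t i))%:E) <->
  exists S : R, forall F, \sum_(i <- F) normc (t i) <= S.
Proof.
have E F : (\sum_(i \in [set` F]%classic) (normc (t i))%:E = (\sum_(i <- F) normc (t i))%:E)%E.
  by rewrite fsbig_finite ?set_fsetK ?sumEFin.
rewrite /summable; under eq_esum do rewrite gee0_abs ?lee_fin ?normc_ge0 //.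
split => [fin|[S HS]]; last first.
  apply: (@le_lt_trans _ _ S%:E); last exact: ltry.
  apply: ub_ereal_sup => _ [X [Xfin _] <-].
  by rewrite fsbig_finite //= sumEFin lee_fin.
have fnum : (\esum_(i in [set: T]%classic) (normc (t i))%:E)%E \is a fin_num.
  by rewrite ge0_fin_numE // esum_ge0 // => i _; rewrite lee_fin normc_ge0.
exists (fine (\esum_(i in [set: T]%classic) (normc (t i))%:E)%E) => F.
rewrite -lee_fin fineK // -E; apply: esum_ge.
by exists [set` F]%classic => //; split.
Qed.

Lemma sum_fset_sub (U : zmodType) (f : T -> U) (F0 F : {fset T}) : (F0 `<=` F)%fset ->
  \sum_(i <- F) f i - \sum_(i <- F0) f i = \sum_(i <- F | i \notin F0) f i.
Proof.
move=> sub; rewrite (bigID (mem F0)) /= addrC; apply/eqP; rewrite subr_eq; apply/eqP.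
congr (_ + _); rewrite big_mkcond /= -(big_fset_incl _ sub); last first.
  by move=> i _ /negbTE ->.
by rewrite big_seq [RHS]big_seq; apply: eq_bigr => i ->.
Qed.

Lemma summable_tail t (S : R) : (forall F, \sum_(i <- F) normc (t i) <= S) ->
  forall eps : R, 0 < eps -> exists F0, forall F, (F0 `<=` F)%fset ->
    normc (\sum_(i <- F) t i - \sum_(i <- F0) t i) < eps.
Proof.
move=> HS eps eps0; pose E := [set \sum_(i <- F) normc (t i) | F in [set: {fset T}]]%classic.
have supE : has_sup E.
  split; first by exists 0, fset0 => //; rewrite big_seq_fset0.
  by exists S => _ [F _ <-].
have [_ [F0 _ <-] HF0] := sup_adherent eps0 supE.
exists F0 => F sub; rewrite sum_fset_sub // -big_filter.
apply: le_lt_trans (normc_sum _ _) _; rewrite big_filter -sum_fset_sub //.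
have : \sum_(i <- F) normc (t i) <= sup E by apply: sup_upper_bound => //; exists F.
lra.
Qed.

Lemma converges_fset t F : (forall i, i \notin F -> t i = 0) ->
  converges_absolutely_to t (\sum_(i <- F) t i).
Proof.
move=> t0; split.
  apply/summable_bounded; exists (\sum_(i <- F) normc (t i)) => G.
  rewrite (big_fset_incl _ (fsubsetUl F G)); last by move=> i _ /t0 ->; exact: Normc.normc0.
  rewrite -subr_ge0 sum_fset_sub ?fsubsetUr // sumr_ge0 // => i _; exact: normc_ge0.
move=> eps eps0; exists F => G FG.
by rewrite (big_fset_incl _ FG) ?subrr ?Normc.normc0 // => i _; exact: t0.
Qed.

End AbsoluteConvergence.

Section Translations.
Context {R : realType} (T : zmodType).
Local Notation C := R[i].
Local Notation normc := Normc.normc.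
Implicit Types (t : T -> C) (F : {fset T}).

Definition translate F (x : T) : {fset T} := [fset (k + x)%R | k in F]%fset.

Lemma sum_translate (U : nmodType) (f : T -> U) F x :
  \sum_(k <- translate F x) f k = \sum_(k <- F) f (k + x).
Proof. by rewrite big_imfset //= => ? ? _ _ /addIr. Qed.

(* With t = sum of t_k y^k, the hypothesis on d says that d = (alpha - beta) t.
   Expanding 1 / (alpha - beta) in powers of beta / alpha bounds t by a
   geometric series. *)
Lemma converges_div t (al be : C) (a b : T) (L : C) :
  normc be < normc al ->
  (forall k, exists m0, forall m, (m0 <= m)%N -> t (k + (a - b) *+ m) = 0) ->
  converges_absolutely_to (fun k => al * t (k - a) - be * t (k - b)) L ->
  converges_absolutely_to t (L / (al - be)).
Proof.
move=> ba t0; pose d k := al * t (k - a) - be * t (k - b).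
rewrite -[fun k => _]/d => -[/summable_bounded[S HS] dL].
have al0 : 0 < normc al by apply: le_lt_trans ba; exact: normc_ge0.
have d0 : 0 < normc al - normc be by rewrite subr_gt0.
have tE k : al * t k = d (k + a) + be * t (k + (a - b)).
  by rewrite /d addrK addrA subrK.
(* B is the fixed point of X = (S + |be| X) / |al|, the bound that the recursion [tE] propagates. *)
pose B := S / (normc al - normc be).
have bnd F : \sum_(k <- F) normc (t k) <= B.
  have [m Hm] : exists m0, forall m, (m0 <= m)%N -> forall k, k \in F -> t (k + (a - b) *+ m) = 0.
    suff ev (s : seq T) : exists m0, forall m, (m0 <= m)%N -> forall k, k \in s -> t (k + (a - b) *+ m) = 0.
      by have [m Hm] := ev F; exists m.
    elim: s => [|k s [m1 H1]]; first by exists 0%N.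
    have [m2 H2] := t0 k; exists (maxn m1 m2) => m; rewrite geq_max => /andP[m1m m2m] l.
    by rewrite inE => /orP[/eqP ->|]; [exact: H2|exact: H1].
  (* Induction on the number of translations by a - b after which t vanishes on F; the translate of
     F needs one fewer. *)
  elim: m F Hm => [|m IH] F HF.
    have S0 : 0 <= S by have := HS fset0; rewrite big_seq_fset0.
    rewrite big_seq big1; first by rewrite /B divr_ge0 // ltW.
    by move=> k kF; have := HF 0%N isT k kF; rewrite mulr0n addr0 => ->; exact: Normc.normc0.
  have := IH (translate F (a - b)); rewrite sum_translate => IHF.
  have {}IHF : \sum_(k <- F) normc (t (k + (a - b))) <= B.
    apply: IHF => n mn _ /imfsetP[k kF ->]; rewrite -addrA -mulrS; exact: HF.
  have : normc al * \sum_(k <- F) normc (t k) <= S + normc be * B.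
    rewrite mulr_sumr; apply: (@le_trans _ _ (\sum_(k <- F) (normc (d (k + a)) + normc be * normc (t (k + (a - b)))))).
      by apply: ler_sum => k _; rewrite -!Normc.normcM tE; exact: normcD.
    rewrite big_split /= -mulr_sumr lerD //; last by rewrite ler_wpM2l ?normc_ge0.
    by have := HS (translate F a); rewrite sum_translate.
  rewrite mulrC -ler_pdivlMr // => /le_trans; apply; rewrite /B le_eqVlt; apply/orP; left; apply/eqP.
  by field; rewrite (gt_eqF d0) (gt_eqF al0).
split; first by apply/summable_bounded; exists B.
have Dn0 : 0 < normc (al - be).
  have := normcD (al - be) be; rewrite subrK; lra.
have D0 : al - be != 0.
  by apply/eqP => D0; move: Dn0; rewrite D0 Normc.normc0 ltxx.
(* The errors will be [e1] for the sum of d and [2 * e1] for each translated sum of t, weighted by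
   |al| and |be|; together they make eps |al - be|. *)
move=> eps eps0; pose e1 := eps * normc (al - be) / (1 + 2 * (normc al + normc be)).
have q0 : 0 < 1 + 2 * (normc al + normc be) by have := normc_ge0 be; lra.
have e10 : 0 < e1 by rewrite divr_gt0 // mulr_gt0.
have [F1 HF1] := summable_tail bnd e10.
have [F2 HF2] := dL e1 e10.
(* With the translates of [F1] included, F and its translates by -a and -b all contain [F1], so
   their sums of t are close. *)
exists (F1 `|` translate F1 a `|` translate F1 b `|` F2)%fset => F.
rewrite !fsubUset => /andP[/andP[/andP[F1F F1aF] F1bF] F2F].
have shifted x : (translate F1 x `<=` F)%fset -> (F1 `<=` translate F (- x))%fset.
  move=> sub; apply/fsubsetP => k kF1; apply/imfsetP; exists (k + x); last by rewrite addrK.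
  by apply: (fsubsetP sub); apply/imfsetP; exists k.
have near x : (F1 `<=` translate F (- x))%fset ->
    normc (\sum_(k <- F) t k - \sum_(k <- F) t (k - x)) < 2 * e1.
  move=> sub; rewrite -(sum_translate t F (- x)).
  have h1 := HF1 _ F1F; have h2 := HF1 _ sub.
  set s0 := \sum_(k <- F1) t k in h1 h2.
  set s1 := \sum_(k <- F) t k in h1 *; set s2 := \sum_(k <- _) t k in h2 *.
  have -> : s1 - s2 = (s1 - s0) - (s2 - s0) by rewrite opprB addrA subrK.
  by have := normcB (s1 - s0) (s2 - s0); lra.
have na := near a (shifted a F1aF); have nb := near b (shifted b F1bF).
have nd := HF2 _ F2F.
set s := \sum_(k <- F) t k in na nb *.
rewrite -(ltr_pM2l Dn0) -Normc.normcM mulrBr [_ * (L / _)]mulrC divfK //.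
have e : \sum_(k <- F) d k = al * \sum_(k <- F) t (k - a) - be * \sum_(k <- F) t (k - b).
  by rewrite !mulr_sumr -sumrB.
rewrite e in nd.
set sa := \sum_(k <- F) t (k - a) in na nd; set sb := \sum_(k <- F) t (k - b) in nb nd.
have -> : (al - be) * s - L = (al * sa - be * sb - L) + (al * (s - sa) - be * (s - sb)).
  by ring.
apply: le_lt_trans (normcD _ _) _.
have h3 := normcB (al * (s - sa)) (be * (s - sb)); rewrite !Normc.normcM in h3.
have h4 : normc al * normc (s - sa) <= normc al * (2 * e1) by rewrite ler_wpM2l ?normc_ge0 // ltW.
have h5 : normc be * normc (s - sb) <= normc be * (2 * e1) by rewrite ler_wpM2l ?normc_ge0 // ltW.
have h6 : normc (al - be) * eps = e1 * (1 + 2 * (normc al + normc be)).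
  by rewrite /e1 divfK ?gt_eqF // mulrC.
rewrite h6; nra.
Qed.

Lemma converges_reindex t L (phi : T -> T) : involutive phi ->
  converges_absolutely_to t L -> converges_absolutely_to (t \o phi) L.
Proof.
move=> phiK [/summable_bounded[S HS] tL].
have E (U : nmodType) (f : T -> U) F : \sum_(i <- F) f (phi i) = \sum_(i <- [fset phi i | i in F]%fset) f i.
  by rewrite big_imfset //= => x y _ _; exact: (inv_inj phiK).
split; first by apply/summable_bounded; exists S => F; rewrite (E _ (fun i => normc (t i))).
move=> eps /tL[F0 HF0]; exists [fset phi i | i in F0]%fset => F sub; rewrite E; apply: HF0.
apply/fsubsetP => i iF0; apply/imfsetP; exists (phi i); last by rewrite phiK.
by apply: (fsubsetP sub); apply/imfsetP; exists i.
Qed.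

End Translations.

(** * Integral and half-integral powers through the exponential *)

Section ComplexExponential.
Context {R : realType}.
Local Notation C := R[i].

Lemma cexp0 : cexp 0 = 1 :> C.
Proof. by rewrite /cexp /= expR0 cos0 sin0 mulr1 mulr0. Qed.

Lemma cexpD (a b : C) : cexp (a + b) = cexp a * cexp b.
Proof.
case: a b => [a1 a2] [b1 b2]; rewrite /cexp /=.
apply/eqP; rewrite eq_complex /= expRD cosD sinD; apply/andP; split; apply/eqP; ring.
Qed.

Lemma cexp_neq0 (a : C) : cexp a != 0.
Proof.
apply/eqP => a0; have := cexpD a (- a); rewrite subrr cexp0 a0 mul0r => /eqP.
by rewrite oner_eq0.
Qed.

Lemma cexpN (a : C) : cexp (- a) = (cexp a)^-1.
Proof. by apply: (mulfI (cexp_neq0 a)); rewrite -cexpD subrr cexp0 mulfV // cexp_neq0. Qed.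

Lemma cexpMn (a : C) (m : nat) : cexp (m%:R * a) = cexp a ^+ m.
Proof.
elim: m => [|m IH]; first by rewrite mul0r cexp0.
by rewrite -natr1 mulrDl mul1r cexpD IH exprSr.
Qed.

Lemma cexpMz (a : C) (m : int) : cexp (m%:~R * a) = cexp a ^ m.
Proof.
case: m => m; first by rewrite -pmulrn cexpMn.
by rewrite NegzE mulrNz mulNr cexpN -pmulrn cexpMn.
Qed.

Lemma cexp_half (l : C) (k : int) : cexp (half k * l) = cexp (l / 2) ^ k.
Proof. by rewrite -cexpMz /half -mulrA [_^-1 * l]mulrC. Qed.

Lemma Re_half (k : int) : complex.Re (half k : C) = half k.
Proof.
have -> : half k = (half k : R)%:C%C :> C.
  by rewrite /half rmorphM fmorphV rmorph_int rmorph_nat.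
by [].
Qed.

End ComplexExponential.

(** * Evaluation of series and division by the differences z_i - z_j *)

Section Monomials.
Context {R : realType} (n : nat).
Local Notation C := R[i].
Local Notation idx := {ffun 'I_n -> int}.
Implicit Types (y : 'I_n -> C) (f g : idx -> C).

(** Exponents being doubled, [y i] stands for a square root of z_i. *)
Definition monomial y (k : idx) : C := \prod_i y i ^ k i.

Lemma monomial_dbl y k i : (forall i, y i != 0) ->
  monomial y k = y i ^+ 2 * monomial y (k - dbl i).
Proof.
move=> y0; rewrite /monomial (bigD1 i) //= [in RHS](bigD1 i) //= mulrA; congr (_ * _).
  by rewrite !idxE eqxx -[y i ^+ 2]/(y i ^ 2) -expfzDr // addrC subrK.
by apply: eq_bigr => j ji; rewrite !idxE (negbTE ji) subr0.
Qed.

(* Truncation along the directions in which 1 / (z_i - z_j) is expanded. *)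
Definition ray_truncated g := forall (i j : 'I_n) (k : idx), (i < j)%N ->
  exists m0, forall m, (m0 <= m)%N -> g (k + (dbl i - dbl j) *+ m) = 0.

Lemma ray_truncated_mulD a b g : ray_truncated g -> ray_truncated (mulD a b g).
Proof.
move=> gr i j k ij.
have [m1 H1] := gr i j (k - dbl a) ij; have [m2 H2] := gr i j (k - dbl b) ij.
exists (maxn m1 m2) => m; rewrite geq_max => /andP[m1m m2m].
by rewrite /mulD /mulX ![k + _ - _]addrAC H1 // H2 // subrr.
Qed.

Definition mulDss (Q : 'I_n -> 'I_n -> nat) (s : 'I_n -> seq 'I_n) (l : seq 'I_n) g :=
  foldr (fun i h => mulDs i (Q i) (s i) h) g l.

Lemma mulDss_ind (P : (idx -> C) -> Prop) Q s l g :
  (forall i j h, j \in s i -> P h -> P (mulD i j h)) -> P g -> P (mulDss Q s l g).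
Proof.
move=> Pm Pg; elim: l => //= i l IH.
by apply: (@mulDs_ind _ _ P) => // j h; exact: Pm.
Qed.

Section Convergence.
Variables (y : 'I_n -> C).
Hypothesis y0 : forall i, y i != 0.
Hypothesis y_lt : forall i j : 'I_n, (i < j)%N ->
  Normc.normc (y j ^+ 2) < Normc.normc (y i ^+ 2).

Definition term g (k : idx) : C := g k * monomial y k.

Lemma converges_mulD (i j : 'I_n) g L : (i < j)%N -> ray_truncated g ->
  converges_absolutely_to (term (mulD i j g)) L ->
  converges_absolutely_to (term g) (L / (y i ^+ 2 - y j ^+ 2)).
Proof.
move=> ij gr; pose d k := y i ^+ 2 * term g (k - dbl i) - y j ^+ 2 * term g (k - dbl j).
have -> : term (mulD i j g) = d.
  apply/funext => k; rewrite /term /d /mulD /mulX mulrBl.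
  by congr (_ - _); [rewrite (monomial_dbl k i y0)|rewrite (monomial_dbl k j y0)]; rewrite mulrCA.
apply: converges_div; first exact: y_lt.
move=> k; have [m0 H] := gr i j k ij; exists m0 => m /H gm.
by rewrite /term gm mul0r.
Qed.

Lemma converges_mulDs (i : 'I_n) Q s g L :
  (forall j : 'I_n, j \in s -> (i < j)%N) -> ray_truncated g ->
  converges_absolutely_to (term (mulDs i Q s g)) L ->
  converges_absolutely_to (term g) (L / \prod_(j <- s) (y i ^+ 2 - y j ^+ 2) ^+ Q j).
Proof.
elim: s L => [|j s IH] L is_ gr /=; first by rewrite big_nil divr1.
have is' l : l \in s -> (i < l)%N by move=> ls; apply: is_; rewrite inE ls orbT.
move=> cv; rewrite big_cons invfM mulrA; apply: IH => //.
have gr' : ray_truncated (mulDs i Q s g).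
  by apply: (@mulDs_ind _ _ (fun h => ray_truncated h)) => // l h _; exact: ray_truncated_mulD.
have gm m : ray_truncated (iter m (mulD i j) (mulDs i Q s g)).
  by elim: m => //= m IHm; exact: ray_truncated_mulD.
elim: (Q j) L cv => [|m IHm] L /= cv; first by rewrite expr0 divr1.
rewrite exprS invfM mulrA; apply: IHm; apply: converges_mulD => //.
by apply: is_; rewrite mem_head.
Qed.

Lemma converges_mulDss Q (s : 'I_n -> seq 'I_n) l g L :
  (forall i j : 'I_n, j \in s i -> (i < j)%N) -> ray_truncated g ->
  converges_absolutely_to (term (mulDss Q s l g)) L ->
  converges_absolutely_to (term g)
    (L / \prod_(i <- l) \prod_(j <- s i) (y i ^+ 2 - y j ^+ 2) ^+ Q i j).
Proof.
elim: l L => [|i l IH] L is_ gr /=; first by rewrite big_nil divr1.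
move=> cv; rewrite big_cons invfM mulrA; apply: IH => //.
apply: converges_mulDs cv; first exact: is_.
by apply: (@mulDss_ind (fun h => ray_truncated h)) => // a b h _; exact: ray_truncated_mulD.
Qed.

End Convergence.

Lemma mulDs_mulD i Q s a b g : mulDs i Q s (mulD a b g) = mulD a b (mulDs i Q s g).
Proof.
pose P (h h' : idx -> C) := h = mulD a b h'.
apply: (@mulDs_rel _ _ _ P) => // j h h' _ ->; rewrite /P; apply/funext => k.
rewrite /mulD /mulX !opprB !addrA.
by rewrite ![k - _ - dbl i]addrAC ![k - _ - dbl j]addrAC; ring.
Qed.

Lemma mulDss_mulDs i q t Q s l g :
  mulDss Q s l (mulDs i q t g) = mulDs i q t (mulDss Q s l g).
Proof.
elim: l => //= j l ->; pose P (h h' : idx -> C) := mulDs j (Q j) (s j) h = h'.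
apply: (@mulDs_rel _ _ _ P) => // b h h' _ <-; exact: mulDs_mulD.
Qed.

(** All the factors commute, so those attached to i can act first; the remaining ones preserve
    truncation. *)
Lemma truncated_mulDss Q s l g (N : int) i : i \in l ->
  truncated N i (mulDs i (Q i) (s i) g) -> truncated N i (mulDss Q s l g).
Proof.
move=> il gi; pose P (h : idx -> C) := truncated N i h.
elim: l il => //= j l IH; rewrite inE => /orP[/eqP <-|/IH Pl].
  by rewrite -mulDss_mulDs; apply: (@mulDss_ind P) => // a b h _; exact: truncated_mulD.
by apply: (@mulDs_ind _ _ P) => // b h _; exact: truncated_mulD.
Qed.

End Monomials.

(** * Supports of correlators *)

Section Support.
Context (R : realType) (V : lmodType R[i]) (A : mosva V) (I : finType).
Local Notation C := R[i].
Local Notation idx := {ffun I -> int}.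
Variables (v : I -> V).

Section Prefix.
Variables (W : lmodType C) (Y : int -> {bilinear V -> W -> W}).
Implicit Types (w x : W) (k : idx) (s : seq I).

Lemma prodY_cat s1 s2 w k :
  prodY Y v (s1 ++ s2) w k = prodY Y v s1 (prodY Y v s2 w k) k.
Proof. exact: foldr_cat. Qed.

Lemma prodY_linear s k : linear (fun w => prodY Y v s w k).
Proof. by move=> c x w; elim: s => //= i s ->; rewrite linearPr. Qed.

Lemma prodY0 s k : prodY Y v s 0 k = 0.
Proof. by elim: s => //= i s ->; rewrite linear0r. Qed.

Lemma prodYB s x w k : prodY Y v s (x - w) k = prodY Y v s x k - prodY Y v s w k.
Proof. by elim: s => //= i s ->; rewrite linearBr. Qed.

(** The operators to the left of i involve only the exponents in [s1], which the factors x_i - x_j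
    with j in [s2] do not touch; these factors therefore pass through them. *)
Lemma truncated_mulDs_prefix (w' : {scalar W}) w i Q s1 s2 (N : int) :
  uniq (s1 ++ i :: s2) ->
  truncated N i (mulDs i Q s2 (prodY Y v (i :: s2) w)) ->
  truncated N i (mulDs i Q s2 (fun k => w' (prodY Y v (s1 ++ i :: s2) w k))).
Proof.
rewrite cat_uniq => /and3P[_ /hasPn s12 _] HN k /HN kN.
pose P (g : idx -> C) (g' : idx -> W) := forall k, g k = w' (prodY Y v s1 (g' k) k).
suff -> : P (mulDs i Q s2 (fun k => w' (prodY Y v (s1 ++ i :: s2) w k)))
            (mulDs i Q s2 (prodY Y v (i :: s2) w)).
  by rewrite kN prodY0 linear0.
apply: (@mulDs_rel _ _ _ P) => [j g g' js Pg k1|k1]; last by rewrite prodY_cat.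
have pX l : l \in i :: s2 -> forall x, prodY Y v s1 x (k1 - dbl l) = prodY Y v s1 x k1.
  move=> ls x; apply: eq_prodY => m ms1; rewrite !idxE.
  by case: eqP => [ml|_]; [have := s12 l ls; rewrite -ml ms1|rewrite subr0].
by rewrite /mulD /mulX !Pg prodYB linearB /= !pX ?mem_head // inE js orbT.
Qed.

Hypothesis Ytr : forall i w, exists N : int, forall l : int, l < N -> Y l (v i) w = 0.

(** Along the ray the exponent of x_j decreases while those to its right stay fixed, so Y(v_j, x_j)
    is eventually truncated on a fixed vector. *)
Lemma prodY_ray s1 j s2 w i k : i \notin j :: s2 -> j \notin s2 ->
  exists m0, forall m, (m0 <= m)%N ->
    prodY Y v (s1 ++ j :: s2) w (k + (dbl i - dbl j) *+ m) = 0.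
Proof.
rewrite inE negb_or => /andP[ij is2] js2; have [N HN] := Ytr j (prodY Y v s2 w k).
exists `|k j - N|.+1 => m mm; rewrite prodY_cat /=.
have -> : prodY Y v s2 w (k + (dbl i - dbl j) *+ m) = prodY Y v s2 w k.
  apply: eq_prodY => l ls; rewrite step_idxm //.
    by apply: contraNneq is2 => <-.
  by apply: contraNneq js2 => <-.
by rewrite HN ?prodY0 // step_idx //; lia.
Qed.

End Prefix.

Section BoundedAbove.
Implicit Types g : idx -> C.

Definition bounded_above g := exists B : int, forall k : idx, B < \sum_i k i -> g k = 0.

Lemma bounded_above_mulD a b g : bounded_above g -> bounded_above (mulD a b g).
Proof.
case=> B HB; have HX i (k : idx) : B + 2 < \sum_i k i -> mulX i g k = 0.
  move=> kB; apply: HB; under eq_bigr do rewrite !idxE.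
  by rewrite sumrB -big_mkcond big_pred1_eq ltrBrDr.
by exists (B + 2) => k kB; rewrite /mulD !HX ?subrr.
Qed.

Lemma bounded_support g (q : I -> nat) : bounded_above g ->
  (forall i, truncated (- (q i)%:Z) i g) ->
  exists F : {fset idx}, forall k, k \notin F -> g k = 0.
Proof.
(* All other exponents being at least -q_j, the total degree bound B also bounds k_i + q_i; [m] is a
   generous common bound. *)
case=> B HB gq; pose m := (`|B| + 2 * \sum_i q i)%N.
pose f (x : {ffun I -> 'I_m.+1}) : idx := [ffun i => (x i : nat)%:Z - (q i)%:Z].
exists [fset k | k in [seq f x | x <- enum {: {ffun I -> 'I_m.+1}}]]%fset => k.
apply: contraNeq => gk; rewrite !inE /=; apply/mapP.
exists [ffun i => inord `|(k i + (q i)%:Z)%R|%N]; first by rewrite mem_enum.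
have kq i : - (q i)%:Z <= k i by rewrite leNgt; apply: contra gk => /gq ->.
have km i : (`|(k i + (q i)%:Z)%R| < m.+1)%N.
  have : \sum_i k i <= B by rewrite leNgt; apply: contra gk => /HB ->.
  rewrite (bigD1 i) //= => kB.
  have : \sum_(j | j != i) - (q j)%:Z <= \sum_(j | j != i) k j by apply: ler_sum.
  rewrite sumrN -(big_morph Posz PoszD (erefl 0)).
  have : (m = `|B| + 2 * (q i + \sum_(j | j != i) q j))%N by rewrite /m (bigD1 i).
  move: kB (kq i); move: (\sum_(j | j != i) k j) (\sum_(j | j != i) q j)%N (m) (k i) => x y z ki; lia.
apply/ffunP => i; rewrite !ffunE inordK ?km // gez0_abs ?addrK //.
by rewrite -lerBlDr sub0r.
Qed.

End BoundedAbove.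

Variables (a : I -> int).
Hypothesis av : forall i, wt_V A (a i) (v i).
Variables (theta : involution A) (W : lmodType C) (M : twisted_module theta W).

Lemma wt_prodY_W m w s (k : idx) : wt_W M m w ->
  wt_W M (m + half (\sum_(i <- s) (k i + a i))) (prodY (Y_W M) v s w k).
Proof.
move=> wm; elim: s => [|i s IH]; first by rewrite big_nil /half mul0r addr0.
have := wt_W_Y (k i) (av i) IH.
by rewrite big_cons /= -addrA -halfz_D addrC [_ + (k i + a i)]addrC addrC.
Qed.

(** The weight of a coefficient grows with the total exponent, and w' vanishes on vectors of large
    weight. *)
Lemma bounded_above_correlator w (w' : {scalar W}) : restricted_dual M w' ->
  bounded_above (fun k => w' (prodY (Y_W M) v (enum I) w k)).
Proof.
move=> fin; have [b Hb] : exists b : R, forall m x, wt_W M m x -> b < complex.Re m -> w' x = 0.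
  exists (\sum_(m <- fset_set [set m : C | exists2 w, wt_W M m w & w' w != 0]%classic) `|complex.Re m|).
  move=> m x mx; apply: contraTeq => w'x; rewrite -leNgt (big_fsetD1 m) /=; last first.
    by rewrite in_fset_set //; apply: mem_set; exists x.
  by apply: le_trans (ler_norm _) _; rewrite lerDl sumr_ge0.
have [c [s [cS ->]]] := coproduct_decomp (wt_W_coproduct M) w.
elim: s => [|m s [B HB]]; first by exists 0 => k _; rewrite big_nil prodY0 linear0.
(* Total exponents above b' are those for which the real part of the weight exceeds b. *)
pose b' := 2 * (b - complex.Re m) - (\sum_i a i)%:~R.
exists (Num.max B (Num.bound `|b'|)%:Z) => k; rewrite gt_max => /andP[kB kb].
rewrite big_cons; have := prodY_linear (Y_W M) (enum I) k 1 (c m) (\sum_(j <- s) c j).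
rewrite !scale1r => ->; rewrite linearD /= HB ?addr0 //.
apply: (Hb _ _ (wt_prodY_W _ k (cS m))).
rewrite raddfD /= Re_half big_enum /= big_split /=.
have : b' < (\sum_i k i)%:~R.
  apply: le_lt_trans (ler_norm _) _; apply: lt_trans (archi_boundP _) _ => //.
  by rewrite pmulrn ltr_int.
by rewrite /b' /half intrD; lra.
Qed.

End Support.

Lemma sorted_split n (s : seq 'I_n) (i : 'I_n) : sorted (fun x y : 'I_n => (x < y)%N) s ->
  i \in s -> exists s1 : seq 'I_n, s = s1 ++ i :: [seq j : 'I_n <- s | (i < j)%N].
Proof.
have tr : transitive (fun x y : 'I_n => (x < y)%N) by move=> y x z; exact: ltn_trans.
elim: s => //= j s IH; rewrite (path_sortedE tr) => /andP[js ss]; rewrite inE.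
case: eqVneq => [->|ij] /= => [_|is_].
  by exists [::]; rewrite ltnn /= (all_filterP js).
have [s1 es] := IH ss is_; exists (j :: s1).
by rewrite ltnNge ltnW ?(allP js) //= -es.
Qed.

Lemma enum_split n (i : 'I_n) :
  exists s1 : seq 'I_n, enum 'I_n = s1 ++ i :: [seq j : 'I_n <- enum 'I_n | (i < j)%N].
Proof.
apply: sorted_split; last by rewrite mem_enum.
by have := iota_ltn_sorted 0 n; rewrite -val_enum_ord sorted_map.
Qed.

(** * Truncation, parity and poles of the correlator *)

Section Correlators.
Context (R : realType) (V : lmodType R[i]) (A : mosva V) (theta : involution A)
  (W : lmodType R[i]) (M : twisted_module theta W).
Local Notation C := R[i].
Context (n : nat) (v : 'I_n -> V) (e : 'I_n -> bool).
Hypothesis hv : forall i, homogeneous A (v i) (e i).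
Context (w : W) (w' : {scalar W}) (hw' : restricted_dual M w').
Local Notation idx := {ffun 'I_n -> int}.

Definition later (i : 'I_n) := [seq j : 'I_n <- enum 'I_n | (i < j)%N].

Definition correlator (k : idx) : C := w' (prodY (Y_W M) v (enum 'I_n) w k).

Lemma later_gt (i j : 'I_n) : j \in later i -> (i < j)%N.
Proof. by rewrite mem_filter => /andP[]. Qed.

Lemma ray_truncated_correlator : ray_truncated correlator.
Proof.
move=> i j k ij; have [s1 es] := enum_split j.
have [|||m0 Hm0] := @prodY_ray _ _ _ v _ (Y_W M) _ s1 j (later j) w i k.
- move=> l x; have [N HN] := Y_W_support M x (hv l).
  by exists N => m mN; apply/eqP/negPn/negP => /HN[_]; rewrite leNgt mN.
- by rewrite inE negb_or mem_filter negb_and -leqNgt (ltnW ij) -val_eqE (ltn_eqF ij).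
- by rewrite mem_filter ltnn.
by exists m0 => m /Hm0; rewrite /correlator es => ->; exact: linear0.
Qed.

Lemma correlator_parity (k : idx) i : correlator k != 0 -> oddz (k i) = e i.
Proof.
have [s1 es] := enum_split i; rewrite /correlator es prodY_cat /=.
have [N HN] := Y_W_support M (prodY (Y_W M) v (later i) w k) (hv i).
apply: contraNeq => ki; have [Y0|/HN[]] := eqVneq (Y_W M (k i) (v i) (prodY (Y_W M) v (later i) w k)) 0.
  by rewrite Y0 prodY0 linear0.
by move/eqP: ki.
Qed.

(** Each [v i] is leftmost in the part of the product that starts at it, and what precedes does not
    affect the bound. *)
Lemma correlator_poles : exists (q : 'I_n -> nat) (Q : 'I_n -> 'I_n -> nat),
  forall i, truncated (- (q i)%:Z) i (mulDs i (Q i) (later i) correlator).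
Proof.
have [a av] := choice (fun i => let: ex_intro2 k vk _ := hv i in ex_intro _ k vk).
have /choice[q /choice[Q HQ]] : forall i, exists (q : nat) (Q : 'I_n -> nat),
    truncated (- q%:Z) i (mulDs i Q (later i) correlator).
  move=> i; have [s1 es] := enum_split i.
  have u : uniq (s1 ++ i :: later i) by rewrite -es enum_uniq.
  have [|q [Q HQ]] := leftmost av w (assoc_module_W M) (lo := i) (s := later i).
    by move: u; rewrite cat_uniq => /and3P[].
  exists q, Q; rewrite /correlator es; exact: truncated_mulDs_prefix.
by exists q, Q.
Qed.

End Correlators.

(** * Finite sums as values of polynomials *)

Section Values.
Context (R : realType) (n : nat).
Local Notation C := R[i].
Local Notation idx := {ffun 'I_n -> int}.

Lemma finite_sum_value (g : idx -> C) (F : {fset idx}) (e : 'I_n -> bool) (q : 'I_n -> nat) :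
  (forall (k : idx) i, g k != 0 -> oddz (k i) = e i) ->
  (forall i, truncated (- (q i)%:Z) i g) ->
  exists P : mpoly n C, forall y : 'I_n -> C, (forall i, y i != 0) ->
    \sum_(k <- F) term y g k =
      (\prod_i y i ^+ e i) * (meval (fun i => y i ^+ 2) P / \prod_i (y i ^+ 2) ^+ q i).
Proof.
move=> ge gq; pose mm (k : idx) : multinom n :=
  Multinom (mktuple (fun i => `|(k i + 2 * (q i)%:Z - (e i)%:Z)%R| %/ 2)%N).
exists (\sum_(k <- F) g k *: mpolyX C (mm k)) => y y0.
rewrite raddf_sum mulr_suml mulr_sumr; apply: eq_bigr => k _ /=.
have [gk|gk] := eqVneq (g k) 0; first by rewrite /term gk mul0r scale0r meval0 mul0r mulr0.
rewrite /term mevalZ mevalX -!mulrA mulrCA; congr (_ * _).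
rewrite -prodfV -!big_split; apply: eq_bigr => i _ /=.
(* Parity and the bound -q_i make k_i + 2 q_i - e_i even and nonnegative, even when q_i = 0, since
   k_i has the parity e_i. *)
have ki : k i = (e i)%:Z + (2 * mm k i)%N%:Z - (2 * q i)%N%:Z.
  have e1 := ge k i gk; have kq : - (q i)%:Z <= k i.
    by rewrite leNgt; apply: contra gk => /gq ->.
  rewrite /mm /fun_of_multinom /= tnth_mktuple; move: e1 kq; rewrite /oddz.
  by move: (k i) (q i) (e i) => x m [] /=; lia.
by rewrite {1}ki !expfzDr // -!exprM -mulrA -exprnN.
Qed.

End Values.

(** * The algebraic function and its branches *)

Theorem proposition2p8 (R : realType) (V : lmodType R[i]) (A : mosva V)
    (theta : involution A) (W : lmodType R[i]) (M : twisted_module theta W)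
    (n : nat) (n_ge1 : (1 <= n)%N) (v : 'I_n -> V) (e : 'I_n -> bool)
    (hv : forall i, homogeneous A (v i) (e i))
    (w : W) (w' : {scalar W}) (hw' : restricted_dual M w') :
  exists (g : mpoly n R[i]) (q : 'I_n -> nat) (qq : 'I_n -> 'I_n -> nat),
    forall (p : int) (z : 'I_n -> R[i]), radially_ordered z ->
      converges_absolutely_to (correlator_term M p v z w w')
        (algebraic_branch p e g q qq z).
Proof.
have [q [Q HQ]] := correlator_poles M hv w w'.
(* Clearing the poles of all variables at once makes the support finite: exponents are then bounded
   below one by one and above in total. *)
pose f := correlator M v w w'; pose g := mulDss Q (@later n) (enum 'I_n) f.
have g_low i : truncated (- (q i)%:Z) i g by apply: truncated_mulDss (HQ i); rewrite mem_enum.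
have g_bounded : bounded_above g.
  apply: (@mulDss_ind _ _ (fun h => bounded_above h)) => [i j h _|]; first exact: bounded_above_mulD.
  have [a av] := choice (fun i => let: ex_intro2 k vk _ := hv i in ex_intro _ k vk).
  exact: (bounded_above_correlator av w hw').
have g_parity (k : {ffun 'I_n -> int}) i : g k != 0 -> oddz (k i) = e i.
  pose P (h : {ffun 'I_n -> int} -> R[i]) := forall k : {ffun 'I_n -> int}, h k != 0 -> oddz (k i) = e i.
  move: k; apply: (@mulDss_ind _ _ P) => [a b h _ Ph|k]; last exact: correlator_parity.
  have PX j (k : {ffun 'I_n -> int}) : mulX j h k != 0 -> oddz (k i) = e i.
    by move=> /Ph <-; rewrite oddz_dbl.
  move=> k; rewrite /mulD; have [ha|/PX //] := eqVneq (mulX a h k) 0.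
  by rewrite ha sub0r oppr_eq0 => /PX.
have [F HF] := bounded_support g_bounded g_low.
have [P HP] := finite_sum_value F g_parity g_low.
exists P, q, Q => p z [z_lt z_gt0].
have z0 i : z i != 0 by apply: contraTneq (z_gt0 i) => ->; rewrite Normc.normc0 ltxx.
(* The square root of z_i on the p-th branch; [P], [q] and [Q] were fixed before p and z. *)
pose y i := cexp (logp p (z i) / 2).
have y0 i : y i != 0 by exact: cexp_neq0.
have y2 i : y i ^+ 2 = z i.
  by rewrite expr2 -cexpD -splitr cexp_logp.
have lt_y (i j : 'I_n) : (i < j)%N -> Normc.normc (y j ^+ 2) < Normc.normc (y i ^+ 2).
  by rewrite !y2; exact: z_lt.
have cv : converges_absolutely_to (term y f)
    (algebraic_branch p e P q Q z).
  have -> : algebraic_branch p e P q Q z = (\sum_(k <- F) term y g k) /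
      \prod_(i <- enum 'I_n) \prod_(j <- later i) (y i ^+ 2 - y j ^+ 2) ^+ Q i j.
    rewrite HP // /algebraic_branch invfM -!mulrA; congr (_ * (_ * _)).
    - by apply: eq_bigr => i _; exact: (cexp_half _ (e i)%:Z).
    - by congr (meval _ _); apply/funext => i; rewrite y2.
    congr (_ * _); first by congr _^-1; apply: eq_bigr => i _; rewrite y2.
    rewrite big_enum; congr _^-1; apply: eq_bigr => i _.
    by rewrite /later big_filter big_enum_cond; apply: eq_bigr => j _; rewrite !y2.
  apply: converges_mulDss => //; [exact: later_gt|exact: ray_truncated_correlator|].
  by apply: converges_fset => k /HF; rewrite /term -/f -/g => ->; rewrite mul0r.
(* The passage between the doubled index m of a mode and the doubled exponent -m - 2 of its power of
   x. *)
pose phi (m : {ffun 'I_n -> int}) : {ffun 'I_n -> int} := [ffun i => - m i - 2].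
have phiK : involutive phi by move=> m; apply/ffunP => i; rewrite !ffunE; ring.
suff -> : correlator_term M p v z w w' = term y f \o phi by exact: converges_reindex cv.
apply/funext => m; rewrite /correlator_term /term /f /correlator /monomial /=.
congr (w' _ * _).
  by rewrite /prodY; elim: (enum 'I_n) => //= i s ->; rewrite ffunE.
apply: eq_bigr => i _; transitivity (cexp (half (phi m i) * logp p (z i))); last exact: cexp_half.
have -> : half (phi m i) = - half (m i) - 1 :> R[i]; last by [].
by rewrite ffunE halfz_D /half !intrN !mulNr divff ?pnatr_eq0.
Qed.
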